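(* Let $u\colon R\to U$ be an epimorphism of commutative rings such that $\operatorname{Tor}^R_1(U,U)=0$. Then the ring $\mathfrak R=\operatorname{Hom}_{\mathsf D^{\mathsf b}(R\text{-mod})}(K^\bullet,K^\bullet)$ is commutative. In particular, if $u$ is injective, then the ring $\mathfrak R=\operatorname{Hom}_R(U/R,U/R)$ is commutative.
   Context: A homomorphism $u\colon R\to U$ of commutative rings is a ring epimorphism iff the multiplication map $U\otimes_R U\to U$ is an isomorphism. $K^\bullet$ denotes the two-term complex of $R$-modules $R\xrightarrow{u}U$ with $R$ in cohomological degree $-1$ and $U$ in cohomological degree $0$, viewed as an object of the bounded derived category $\mathsf D^{\mathsf b}(R\text{-mod})$ of $R$-modules; the ring structure on its endomorphisms is given by composition. $U/R$ denotes the cokernel of $u$. *)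

(* Defs.v *)
From HB Require Import structures.
From mathcomp Require Import all_boot all_order all_algebra.
From mathcomp Require Import boolp classical_sets functions cardinality fsbigop.
Set Implicit Arguments.
Unset Strict Implicit.
Unset Printing Implicit Defensive.
Import GRing.Theory.
Local Open Scope classical_set_scope.
Local Open Scope ring_scope.
Local Open Scope quotient_scope.

Lemma linear_ext (R : pzRingType) (M N : lmodType R) (f g : {linear M -> N}) :
  f =1 g -> f = g.
Proof.
case: f g => [f [[fD] [fZ]]] [g [[gD] [gZ]]] /= /funext fg.
move: fg fD fZ gD gZ => /= -> fD fZ gD gZ.
by rewrite (Prop_irrelevance fD gD) (Prop_irrelevance fZ gZ).
Qed.

Section LinearMaps.
Variable R : pzRingType.
Implicit Types M N P : lmodType R.

Definition mklin M N (f : M -> N) (f_lin : linear f) : {linear M -> N} :=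
  HB.pack_for {linear M -> N} f (GRing.isLinear.Build R M N *:%R f f_lin).

Lemma mklinE M N (f : M -> N) (f_lin : linear f) x : mklin f_lin x = f x.
Proof. by []. Qed.

Definition lin_id M : {linear M -> M} := idfun.
Definition lin_zero M N : {linear M -> N} := \0.
Definition lin_comp M N P (g : {linear N -> P}) (f : {linear M -> N}) :
  {linear M -> P} := g \o f.
Definition lin_add M N (f g : {linear M -> N}) : {linear M -> N} := f \+ g.
Definition lin_opp M N (f : {linear M -> N}) : {linear M -> N} := \- f.

End LinearMaps.

Arguments mklin : simpl never.

Section QuotientModule.
Variables (R : pzRingType) (M : lmodType R) (S : set M).

Inductive span : M -> Prop :=
| span0 : span 0
| span_gen x : S x -> span x
| spanD x y : span x -> span y -> span (x + y)
| spanZ a x : span x -> span (a *: x).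

Lemma spanN x : span x -> span (- x).
Proof. by rewrite -scaleN1r; exact: spanZ. Qed.

Definition eqmodspan (x y : M) := `[< span (x - y) >].

Lemma eqmodspan_refl : reflexive eqmodspan.
Proof. by move=> x; apply/asboolP; rewrite subrr; exact: span0. Qed.

Lemma eqmodspan_sym : symmetric eqmodspan.
Proof.
move=> x y; apply/asboolP/asboolP => h; rewrite -opprB;
exact: spanN.
Qed.

Lemma eqmodspan_trans : transitive eqmodspan.
Proof.
move=> y x z /asboolP h /asboolP h'; apply/asboolP.
by have := spanD h h'; rewrite addrA subrK.
Qed.

Canonical eqmodspan_equiv :=
  EquivRel eqmodspan eqmodspan_refl eqmodspan_sym eqmodspan_trans.

(* The quotient of M by the submodule spanned by S. *)
Definition quotmod : Type := {eq_quot eqmodspan}.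
HB.instance Definition _ := Choice.on quotmod.
HB.instance Definition _ := EqQuotient.on quotmod.

Definition quotmod_pi (x : M) : quotmod := \pi_quotmod x.

Lemma quotmod_ind (P : quotmod -> Prop) :
  (forall x, P (quotmod_pi x)) -> forall q, P q.
Proof. by move=> Ppi q; rewrite -[q]reprK; exact: Ppi. Qed.

Lemma quotmod_eqP (x y : M) : quotmod_pi x = quotmod_pi y <-> span (x - y).
Proof.
split=> [/eqquotP h|h]; first exact/asboolP.
by apply/eqquotP/asboolP.
Qed.

Let qzero : quotmod := quotmod_pi 0.
Let qadd (x y : quotmod) : quotmod := quotmod_pi (repr x + repr y).
Let qopp (x : quotmod) : quotmod := quotmod_pi (- repr x).
Let qscale (a : R) (x : quotmod) : quotmod := quotmod_pi (a *: repr x).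

Let reprS x : span (repr (quotmod_pi x) - x).
Proof. by apply/quotmod_eqP; rewrite /quotmod_pi reprK. Qed.

Let qaddE x y : qadd (quotmod_pi x) (quotmod_pi y) = quotmod_pi (x + y).
Proof.
apply/quotmod_eqP; rewrite opprD addrACA.
exact: spanD (reprS _) (reprS _).
Qed.

Let qoppE x : qopp (quotmod_pi x) = quotmod_pi (- x).
Proof. by apply/quotmod_eqP; rewrite -opprD; exact: spanN (reprS _). Qed.

Let qscaleE a x : qscale a (quotmod_pi x) = quotmod_pi (a *: x).
Proof. by apply/quotmod_eqP; rewrite -scalerBr; exact: spanZ (reprS _). Qed.

Let qaddA : associative qadd.
Proof.
move=> x y z; elim/quotmod_ind: x => x; elim/quotmod_ind: y => y.
elim/quotmod_ind: z => z.
by rewrite !qaddE addrA.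
Qed.

Let qaddC : commutative qadd.
Proof.
move=> x y; elim/quotmod_ind: x => x; elim/quotmod_ind: y => y.
by rewrite !qaddE addrC.
Qed.

Let qadd0 : left_id qzero qadd.
Proof. by move=> x; elim/quotmod_ind: x => x; rewrite !qaddE add0r. Qed.

Let qaddN : left_inverse qzero qopp qadd.
Proof. by move=> x; elim/quotmod_ind: x => x; rewrite qoppE qaddE addNr. Qed.

HB.instance Definition _ :=
  GRing.isZmodule.Build quotmod qaddA qaddC qadd0 qaddN.

Let qscaleA a b x : qscale a (qscale b x) = qscale (a * b) x.
Proof. by elim/quotmod_ind: x => x; rewrite !qscaleE scalerA. Qed.

Let qscale1 : left_id 1 qscale.
Proof. by move=> x; elim/quotmod_ind: x => x; rewrite qscaleE scale1r. Qed.

Let qscaleDr : right_distributive qscale +%R.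
Proof.
move=> a x y; elim/quotmod_ind: x => x; elim/quotmod_ind: y => y.
by rewrite [_ + _]qaddE !qscaleE [RHS]qaddE scalerDr.
Qed.

Let qscaleDl x : {morph qscale^~ x : a b / a + b}.
Proof.
elim/quotmod_ind: x => x a b /=; rewrite !qscaleE [RHS]qaddE.
by rewrite scalerDl.
Qed.

HB.instance Definition _ := GRing.Zmodule_isLmodule.Build R quotmod
  qscaleA qscale1 qscaleDr qscaleDl.

Lemma quotmod_pi_linear : linear quotmod_pi.
Proof.
by move=> a x y; rewrite -qaddE -qscaleE. Qed.

HB.instance Definition _ :=
  GRing.isLinear.Build R M quotmod *:%R quotmod_pi quotmod_pi_linear.

Section Lift.
Variables (N : lmodType R) (f : {linear M -> N}).
Hypothesis fS : forall x, S x -> f x = 0.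

Lemma span_lift x : span x -> f x = 0.
Proof.
elim=> [|y /fS//|y z _ fy _ fz|a y _ fy]; first exact: linear0.
- by rewrite linearD fy fz addr0.
- by rewrite linearZ /= fy scaler0.
Qed.

Let lift (x : quotmod) : N := f (repr x).

Let liftE x : lift (quotmod_pi x) = f x.
Proof.
by apply/eqP; rewrite -subr_eq0 -linearB; apply/eqP/span_lift/reprS.
Qed.

Let lift_linear : linear lift.
Proof.
move=> a x y; elim/quotmod_ind: x => x; elim/quotmod_ind: y => y.
by rewrite -linearP !liftE linearP.
Qed.

Definition quotmod_lift : {linear quotmod -> N} := mklin lift_linear.

Lemma quotmod_liftE x : quotmod_lift (quotmod_pi x) = f x.
Proof. exact: liftE. Qed.

End Lift.
End QuotientModule.
Arguments quotmod_lift : simpl never.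

Section Homology.
Variable R : pzRingType.
Implicit Types A B C : lmodType R.

Section Kernel.
Variables (B C : lmodType R) (g : {linear B -> C}).

Definition lker : {pred B} := [pred x | g x == 0].

Lemma lker_submod : submod_closed lker.
Proof.
split=> [|a x y]; rewrite !inE ?linear0 // linearP => /eqP-> /eqP->.
by rewrite scaler0 addr0.
Qed.

HB.instance Definition _ := GRing.isSubmodClosed.Build R B lker lker_submod.

Record kermod := Kermod { ker_val :> B; _ : ker_val \in lker }.
HB.instance Definition _ := [isSub for ker_val].
HB.instance Definition _ := [Choice of kermod by <:].
HB.instance Definition _ := [SubChoice_isSubLmodule of kermod by <:].

Definition ker_incl : {linear kermod -> B} := val.

Lemma kermodP (x : kermod) : g (ker_incl x) = 0.
Proof. by apply/eqP; exact: (valP x). Qed.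

End Kernel.

Definition homology A B C (f : {linear A -> B}) (g : {linear B -> C}) :=
  quotmod [set x : kermod g | exists y, val x = f y].

End Homology.

Section FreeModule.
Variables (R : pzRingType) (X : choiceType).

Definition fin_supp : {pred X -> R^o} :=
  [pred f | `[< finite_set [set x | f x != 0] >]].

Lemma fin_suppP f : reflect (finite_set [set x | f x != 0]) (f \in fin_supp).
Proof. exact: asboolP. Qed.

Lemma fin_supp_submod : submod_closed fin_supp.
Proof.
split=> [|a f g].
  apply/fin_suppP; rewrite (_ : [set _ | _] = set0).
    exact: finite_set0.
  by apply/seteqP; split=> x //=; rewrite eqxx.
move=> /fin_suppP fF /fin_suppP gF; apply/fin_suppP.
apply: (@sub_finite_set _ _ ([set x | f x != 0] `|` [set x | g x != 0])).
  move=> x /=; apply: contraPP => /not_orP[/negP + /negP].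
  rewrite !negbK => /eqP f0 /eqP g0; apply/negP; rewrite negbK.
  have -> : (a *: f + g) x = a * f x + g x by [].
  by rewrite f0 g0 mulr0 addr0.
by rewrite finite_setU.
Qed.

HB.instance Definition _ :=
  GRing.isSubmodClosed.Build R (X -> R^o) fin_supp fin_supp_submod.

Record freemod := Freemod { free_coef :> X -> R^o; _ : free_coef \in fin_supp }.
HB.instance Definition _ := [isSub for free_coef].
HB.instance Definition _ := [Choice of freemod by <:].
HB.instance Definition _ := [SubChoice_isSubLmodule of freemod by <:].

Lemma free_gen_fin (x : X) : (fun y => (x == y)%:R : R^o) \in fin_supp.
Proof.
apply/fin_suppP/(@sub_finite_set _ _ [set x]) => // y /=.
by case: (x =P y) => [->|_] //; rewrite eqxx.
Qed.

Definition free_gen (x : X) : freemod := Freemod (free_gen_fin x).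

Section Lift.
Variables (M : lmodType R) (g : X -> M).

Let lift (f : freemod) : M := \sum_(x \in [set: X]) (f x : R) *: g x.

Let liftE (s : seq X) (f : freemod) : uniq s ->
  (forall x, f x != 0 -> x \in s) -> lift f = \sum_(x <- s) (f x : R) *: g x.
Proof.
move=> us fs; rewrite /lift (fsbigE s) //= => [|x _ xs].
  by apply: eq_bigl => x; rewrite mem_set.
have [->|/fs] := eqVneq (f x : R) 0; first by rewrite scale0r.
by rewrite (negPf xs).
Qed.

Lemma free_supp (f : freemod) :
  exists2 s : seq X, uniq s & forall x, f x != 0 -> x \in s.
Proof.
case: f => f /=; move=> /fin_suppP /finite_seqP[s fs].
exists (undup s) => [|x fx]; first exact: undup_uniq.
by rewrite mem_undup; have : [set` s] x by rewrite -fs.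
Qed.

Let lift_linear : linear lift.
Proof.
move=> a f h; have [s us fs] := free_supp f; have [t ut ht] := free_supp h.
pose r := undup (s ++ t); have ur : uniq r by exact: undup_uniq.
have fr x : f x != 0 -> x \in r by rewrite mem_undup mem_cat => /fs->.
have hr x : h x != 0 -> x \in r by rewrite mem_undup mem_cat orbC => /ht->.
rewrite (liftE ur fr) (liftE ur hr) (@liftE r) // => [|x].
  rewrite scaler_sumr -big_split; apply: eq_bigr => x _ /=.
  by rewrite scalerA -scalerDl.
have -> : (a *: f + h) x = a * f x + h x by [].
apply: contraR => xr; have f0 : f x = 0.
  by apply/eqP; apply: contraNT xr; exact: fr.
have h0 : h x = 0 by apply/eqP; apply: contraNT xr; exact: hr.
by rewrite f0 h0 mulr0 addr0.
Qed.

Definition free_lift : {linear freemod -> M} := mklin lift_linear.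

Lemma free_liftE x : free_lift (free_gen x) = g x.
Proof.
rewrite mklinE (@liftE [:: x]) //= => [|y]; last first.
  by rewrite inE; case: (x =P y) => [->|_] //=; rewrite ?eqxx // eq_sym eqxx.
by rewrite big_seq1 eqxx scale1r.
Qed.

End Lift.

Lemma free_coefD (f h : freemod) x : (f + h) x = f x + h x.
Proof. by []. Qed.

Lemma free_coefZ a (f : freemod) x : (a *: f) x = a * f x.
Proof. by []. Qed.

Lemma free_decomp (f : freemod) :
  exists s : seq X, f = \sum_(x <- s) (f x : R) *: free_gen x.
Proof.
have [s us fs] := free_supp f; exists s; apply/val_inj/funext => y /=.
have -> : val (\sum_(x <- s) (f x : R) *: free_gen x) y =
    \sum_(x <- s) f x * (x == y)%:R.
  elim: s {us fs} => [|x s ih]; first by rewrite !big_nil.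
  by rewrite !big_cons -ih.
have [ys|ys] := boolP (y \in s).
  rewrite (bigD1_seq y) //= eqxx mulr1 big1 ?addr0 // => x /negPf->.
  by rewrite mulr0.
rewrite big_seq big1 => [|x xs].
  by apply/eqP; apply: contraNT ys; exact: fs.
case: eqP => [xy|_]; last by rewrite mulr0.
by rewrite -xy xs in ys.
Qed.

Lemma free_ext (M : lmodType R) (g h : {linear freemod -> M}) :
  (forall x, g (free_gen x) = h (free_gen x)) -> g =1 h.
Proof.
move=> gh f; have [s ->] := free_decomp f.
rewrite !linear_sum; apply: eq_bigr => x _.
by rewrite !linearZ /= gh.
Qed.

End FreeModule.
Arguments free_lift : simpl never.

Section Tensor.
Variable R : comPzRingType.
Implicit Types M N : lmodType R.

Section TensorProduct.
Variables M N : lmodType R.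

Let gen (m : M) (n : N) : freemod R (M * N)%type := free_gen R (m, n).

Inductive tensor_rel : set (freemod R (M * N)%type) :=
| tensor_relDl m m' n : tensor_rel (gen (m + m') n - (gen m n + gen m' n))
| tensor_relDr m n n' : tensor_rel (gen m (n + n') - (gen m n + gen m n'))
| tensor_relZl a m n : tensor_rel (gen (a *: m) n - a *: gen m n)
| tensor_relZr a m n : tensor_rel (gen m (a *: n) - a *: gen m n).

Definition tensor : lmodType R := quotmod tensor_rel.

Definition tens (m : M) (n : N) : tensor := quotmod_pi tensor_rel (gen m n).

Lemma tensDl m m' n : tens (m + m') n = tens m n + tens m' n.
Proof.
rewrite /tens -linearD; apply/quotmod_eqP/span_gen; exact: tensor_relDl.
Qed.

Lemma tensDr m n n' : tens m (n + n') = tens m n + tens m n'.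
Proof.
rewrite /tens -linearD; apply/quotmod_eqP/span_gen; exact: tensor_relDr.
Qed.

Lemma tensZl a m n : tens (a *: m) n = a *: tens m n.
Proof.
rewrite /tens -linearZ; apply/quotmod_eqP/span_gen; exact: tensor_relZl.
Qed.

Lemma tensZr a m n : tens m (a *: n) = a *: tens m n.
Proof.
rewrite /tens -linearZ; apply/quotmod_eqP/span_gen; exact: tensor_relZr.
Qed.

Section Lift.
Variables (P : lmodType R) (b : M -> N -> P).
Hypothesis bDl : forall m m' n, b (m + m') n = b m n + b m' n.
Hypothesis bDr : forall m n n', b m (n + n') = b m n + b m n'.
Hypothesis bZl : forall a m n, b (a *: m) n = a *: b m n.
Hypothesis bZr : forall a m n, b m (a *: n) = a *: b m n.

Let b0 : {linear freemod R (M * N)%type -> P} :=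
  free_lift (fun mn : M * N => b mn.1 mn.2).

Let b0E m n : b0 (gen m n) = b m n.
Proof. exact: (free_liftE _ (m, n)). Qed.

Lemma tensor_lift_rel x : tensor_rel x -> b0 x = 0.
Proof.
by case=> *; rewrite linearB; apply/eqP; rewrite subr_eq0 ?linearD ?linearZZ;
  rewrite !b0E ?(bDl, bDr, bZl, bZr).
Qed.

Definition tensor_lift : {linear tensor -> P} := quotmod_lift tensor_lift_rel.

Lemma tensor_liftE m n : tensor_lift (tens m n) = b m n.
Proof. by rewrite quotmod_liftE b0E. Qed.

End Lift.

Lemma tensor_ext (P : lmodType R) (f g : {linear tensor -> P}) :
  (forall m n, f (tens m n) = g (tens m n)) -> f =1 g.
Proof.
move=> fg x; elim/quotmod_ind: x => x.
pose q : {linear _ -> tensor} := quotmod_pi tensor_rel.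
have fgq : forall p, lin_comp f q (free_gen R p) = lin_comp g q (free_gen R p).
  by case=> m n; exact: fg.
exact: free_ext fgq x.
Qed.

End TensorProduct.

Section TensorMap.
Variables (M N M' N' : lmodType R).
Variables (f : {linear M -> M'}) (g : {linear N -> N'}).

Program Definition tensor_map : {linear tensor M N -> tensor M' N'} :=
  @tensor_lift M N _ (fun m n => tens (f m) (g n)) _ _ _ _.
Next Obligation. by rewrite linearD tensDl. Qed.
Next Obligation. by rewrite linearD tensDr. Qed.
Next Obligation. by rewrite linearZ /= tensZl. Qed.
Next Obligation. by rewrite linearZ /= tensZr. Qed.

Lemma tensor_mapE m n : tensor_map (tens m n) = tens (f m) (g n).
Proof. exact: tensor_liftE. Qed.

End TensorMap.
End Tensor.
Arguments tensor_lift : simpl never.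

Section Tor.
Variable R : comPzRingType.
Implicit Types M N : lmodType R.

Definition free_cover M : {linear freemod R M -> M} := free_lift id.
Definition syzygy M : lmodType R := kermod (free_cover M).

(* The differential F (syzygy M) -> F M of the free resolution
   ... -> F (syzygy (syzygy M)) -> F (syzygy M) -> F M -> M -> 0,
   where F X is the free module on the underlying set of X. *)
Definition res_diff M : {linear freemod R (syzygy M) -> freemod R M} :=
  lin_comp (ker_incl (free_cover M)) (free_cover (syzygy M)).

Definition Tor1 M N : lmodType R :=
  homology (tensor_map (res_diff (syzygy M)) (lin_id N))
           (tensor_map (res_diff M) (lin_id N)).

End Tor.

(* The R-module underlying U. *)
Definition restr (R U : comPzRingType) (u : {rmorphism R -> U}) : Type := U.

Section RingMap.
Variables (R U : comPzRingType) (u : {rmorphism R -> U}).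

HB.instance Definition _ := GRing.Zmodule.on (restr u).

Let scale (a : R) (x : restr u) : restr u := u a * (x : U).

Let scaleA a b x : scale a (scale b x) = scale (a * b) x.
Proof. by rewrite /scale rmorphM mulrA. Qed.
Let scale1 : left_id 1 scale.
Proof. by move=> x; rewrite /scale rmorph1 mul1r. Qed.
Let scaleDr : right_distributive scale +%R.
Proof. by move=> a x y; exact: mulrDr. Qed.
Let scaleDl x : {morph scale^~ x : a b / a + b}.
Proof. by move=> a b; rewrite /scale rmorphD mulrDl. Qed.

HB.instance Definition _ :=
  GRing.Zmodule_isLmodule.Build R (restr u) scaleA scale1 scaleDr scaleDl.

Lemma restr_scaleE (a : R) (x : restr u) : a *: x = u a * (x : U) :> U.
Proof. by []. Qed.

Program Definition restr_mul :
    {linear tensor (restr u) (restr u) -> restr u} :=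
  @tensor_lift R (restr u) (restr u) (restr u)
    (fun x y => (x : U) * (y : U)) _ _ _ _.
Next Obligation. exact: mulrDl. Qed.
Next Obligation. exact: mulrDr. Qed.
Next Obligation. by rewrite !restr_scaleE mulrA. Qed.
Next Obligation. by rewrite !restr_scaleE mulrCA. Qed.

(* u is an epimorphism of rings iff the multiplication U (x)_R U -> U is an
   isomorphism; this criterion is taken as the definition. *)
Definition ring_epi : Prop := bijective restr_mul.

Lemma restr_map_linear : linear (u : R^o -> restr u).
Proof. by move=> a x y; rewrite rmorphD rmorphM. Qed.

Definition restr_map : {linear R^o -> restr u} := mklin restr_map_linear.

Definition coker : lmodType R := quotmod (range restr_map).

End RingMap.

Section Complexes.
Variable R : comPzRingType.

(* Bounded cochain complexes; only the differentials d i (i + 1) may be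
   nonzero, the others are present to avoid transports along equalities of
   degrees. *)
Record cpx := Cpx {
  cpx_ob :> int -> lmodType R;
  cpx_d : forall i j, {linear cpx_ob i -> cpx_ob j};
  cpx_shape : forall i j x, j != i + 1 -> cpx_d i j x = 0;
  cpx_dd : forall i j k x, cpx_d j k (cpx_d i j x) = 0;
  cpx_bounded : exists n : nat, forall i (x : cpx_ob i), (n < `|i|)%N -> x = 0
}.

Definition cohomology (X : cpx) (i : int) : lmodType R :=
  homology (cpx_d X (i - 1) i) (cpx_d X i (i + 1)).

Record cmap (X Y : cpx) := Cmap {
  cmap_fun :> forall i, {linear X i -> Y i};
  cmap_d : forall i j x, cmap_fun j (cpx_d X i j x) = cpx_d Y i j (cmap_fun i x)
}.

Lemma cmap_ext X Y (f g : cmap X Y) : (forall i, f i =1 g i) -> f = g.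
Proof.
case: f g => [f fd] [g gd] /= fg.
have {}fg : f = g.
  by apply: functional_extensionality_dep => i; apply: linear_ext; exact: fg.
by case: g / fg gd => gd; rewrite (Prop_irrelevance fd gd).
Qed.

Program Definition cmap_id X : cmap X X := @Cmap X X (fun i => lin_id (X i)) _.

Program Definition cmap_comp X Y Z (g : cmap Y Z) (f : cmap X Y) : cmap X Z :=
  @Cmap X Z (fun i => lin_comp (g i) (f i)) _.
Next Obligation. by rewrite !cmap_d. Qed.

Section CohomologyMap.
Variables (X Y : cpx) (f : cmap X Y) (i : int).

Lemma cmap_kerP (x : kermod (cpx_d X i (i + 1))) :
  f i (val x) \in lker (cpx_d Y i (i + 1)).
Proof. by rewrite inE -cmap_d kermodP linear0. Qed.

Let kmap x : kermod (cpx_d Y i (i + 1)) := Kermod (cmap_kerP x).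

Let kmap_linear : linear kmap.
Proof. by move=> a x y; apply: val_inj; rewrite /= linearP. Qed.

Definition cocycle_map :
  {linear kermod (cpx_d X i (i + 1)) -> kermod (cpx_d Y i (i + 1))} :=
  mklin kmap_linear.

Let cmap_bound :=
  lin_comp (quotmod_pi [set y : kermod (cpx_d Y i (i + 1)) |
                         exists z, val y = cpx_d Y (i - 1) i z]) cocycle_map.

Lemma cmap_boundP x : (exists z, val x = cpx_d X (i - 1) i z) ->
  cmap_bound x = 0.
Proof.
move=> [z xz]; rewrite -(linear0 (quotmod_pi _)).
apply/quotmod_eqP; rewrite subr0; apply: span_gen; exists (f (i - 1) z).
by rewrite -cmap_d -xz.
Qed.

Definition cohomology_map : {linear cohomology X i -> cohomology Y i} :=
  quotmod_lift cmap_boundP.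

End CohomologyMap.

Definition quasi_iso X Y (f : cmap X Y) : Prop :=
  forall i, bijective (cohomology_map f i).

Lemma quotmod_pi0P (M : lmodType R) (S : set M) x :
  quotmod_pi S x = 0 <-> span S x.
Proof.
by rewrite -(linear0 (quotmod_pi S)) quotmod_eqP subr0.
Qed.

Lemma cohomology_pi0P (X : cpx) i (x : kermod (cpx_d X i (i + 1))) :
  quotmod_pi [set x : kermod (cpx_d X i (i + 1)) |
                exists z, val x = cpx_d X (i - 1) i z] x = 0 <->
  exists z, val x = cpx_d X (i - 1) i z.
Proof.
rewrite quotmod_pi0P; split=> [|xz]; last exact: span_gen.
elim=> [|//|y z _ [y' yy'] _ [z' zz']|a y _ [y' yy']].
- by exists 0; rewrite !linear0.
- by exists (y' + z'); rewrite [RHS]linearD -yy' -zz'.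
- by exists (a *: y'); rewrite [RHS]linearZZ -yy'.
Qed.

Lemma quasi_isoP X Y (f : cmap X Y) : quasi_iso f <-> forall i,
  (forall x, cpx_d X i (i + 1) x = 0 ->
     (exists z, f i x = cpx_d Y (i - 1) i z) ->
     exists z, x = cpx_d X (i - 1) i z) /\
  (forall y, cpx_d Y i (i + 1) y = 0 -> exists x, cpx_d X i (i + 1) x = 0 /\
     exists z, y - f i x = cpx_d Y (i - 1) i z).
Proof.
split=> [fq i|fq i].
  have fi : injective (cohomology_map f i) by exact: bij_inj.
  have [g _ gK] := fq i; split=> [x /eqP dx [z fxz]|y /eqP dy].
    have /(_ (Kermod dx)) := @cohomology_pi0P X i => -[+ _]; apply.
    apply: fi; rewrite quotmod_liftE linear0; apply/cohomology_pi0P.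
    by exists z.
  pose q := quotmod_pi [set y : kermod (cpx_d Y i (i + 1)) |
                exists z, val y = cpx_d Y (i - 1) i z] (Kermod dy).
  have := gK q; elim/quotmod_ind: (g q) => x; rewrite quotmod_liftE.
  move=> /eqP; rewrite eq_sym -subr_eq0 -linearB => /eqP /cohomology_pi0P[z e].
  by exists (val x); split; [exact: kermodP | exists z].
have f0 x : cohomology_map f i x = 0 -> x = 0.
  elim/quotmod_ind: x => x.
  rewrite quotmod_liftE => /cohomology_pi0P; case: x => x dx [z /= e].
  apply/cohomology_pi0P; apply: (fq i).1; first exact/eqP.
  by exists z.
have fi : injective (cohomology_map f i).
  move=> x y /eqP; rewrite -subr_eq0 -linearB => /eqP/f0/eqP.
  by rewrite subr_eq0 => /eqP.
have fs y : exists x, cohomology_map f i x = y.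
  elim/quotmod_ind: y => -[y dy].
  have [x [/eqP dx [z e]]] := (fq i).2 y (eqP dy).
  exists (quotmod_pi _ (Kermod dx)); rewrite quotmod_liftE.
  apply/esym/eqP; rewrite -subr_eq0 -linearB; apply/eqP/cohomology_pi0P.
  by exists z.
have [g gK] := choice fs.
by exists g => // x; apply: fi; rewrite gK.
Qed.

End Complexes.

Section DirectSum.
Variable R : comPzRingType.

Definition lin_pair (A B C : lmodType R) (f : {linear A -> B})
  (g : {linear A -> C}) : {linear A -> (B * C)%type} :=
  @mklin R A (B * C)%type (fun x => (f x, g x))
    (fun a x y => f_equal2 pair (linearP f a x y) (linearP g a x y)).

Definition lin_fst (A B : lmodType R) : {linear (A * B)%type -> A} := fst.
Definition lin_snd (A B : lmodType R) : {linear (A * B)%type -> B} := snd.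

Variables X Y : cpx R.

Let ob i : lmodType R := (X i * Y i)%type.
Let d i j : {linear ob i -> ob j} :=
  lin_pair (lin_comp (cpx_d X i j) (lin_fst _ _))
           (lin_comp (cpx_d Y i j) (lin_snd _ _)).

Program Definition cpx_sum : cpx R := @Cpx R ob d _ _ _.
Next Obligation. by apply: f_equal2; exact: cpx_shape. Qed.
Next Obligation. by apply: f_equal2; exact: cpx_dd. Qed.
Next Obligation.
have [[n nX] [m mY]] := (cpx_bounded X, cpx_bounded Y).
exists (maxn n m) => i [x y]; rewrite gtn_max => /andP[ni mi].
by rewrite (nX _ x ni) (mY _ y mi).
Qed.

Program Definition cmap_fst : cmap cpx_sum X :=
  @Cmap R cpx_sum X (fun i => lin_fst _ _) _.
Program Definition cmap_snd : cmap cpx_sum Y :=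
  @Cmap R cpx_sum Y (fun i => lin_snd _ _) _.

Program Definition cmap_pair Z (f : cmap Z X) (g : cmap Z Y) : cmap Z cpx_sum :=
  @Cmap R Z cpx_sum (fun i => lin_pair (f i) (g i)) _.
Next Obligation. by apply: f_equal2; exact: cmap_d. Qed.

End DirectSum.

Section ChainMaps.
Variable R : comPzRingType.
Implicit Types X Y Z : cpx R.

Definition cmap_zero X Y : cmap X Y :=
  @Cmap R X Y (fun i => lin_zero (X i) (Y i)) (fun i j x => esym (linear0 _)).

Program Definition cmap_add X Y (f g : cmap X Y) : cmap X Y :=
  @Cmap R X Y (fun i => lin_add (f i) (g i)) _.
Next Obligation. by rewrite !cmap_d linearD. Qed.

Program Definition cmap_opp X Y (f : cmap X Y) : cmap X Y :=
  @Cmap R X Y (fun i => lin_opp (f i)) _.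
Next Obligation. by rewrite !cmap_d linearN. Qed.

Definition cmap_suml X Y Z (f : cmap X Y) : cmap (cpx_sum X Z) (cpx_sum Y Z) :=
  cmap_pair (cmap_comp f (cmap_fst X Z)) (cmap_snd X Z).

Definition cmap_codiag X : cmap (cpx_sum X X) X :=
  cmap_add (cmap_fst X X) (cmap_snd X X).

Definition cmap_swap X Y : cmap (cpx_sum X Y) (cpx_sum Y X) :=
  cmap_pair (cmap_snd X Y) (cmap_fst X Y).

Lemma cmap_suml_qi X Y Z (f : cmap X Y) :
  quasi_iso f -> quasi_iso (cmap_suml Z f).
Proof.
move=> /quasi_isoP fq; apply/quasi_isoP => i; split.
  move=> [x z] [dx dz] [[y z']] [fx ez].
  have [w xw] := (fq i).1 x dx (ex_intro _ y fx).
  by exists (w, z'); exact: (f_equal2 pair xw ez).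
move=> [y z] [dy dz]; have [x [dx [w e]]] := (fq i).2 y dy.
exists (x, z); split; first exact: (f_equal2 pair dx dz).
exists (w, 0); apply: (f_equal2 pair e).
by rewrite [RHS]linear0 subrr.
Qed.

End ChainMaps.

(* The bounded derived category as the localization of the category of bounded
   complexes at the quasi-isomorphisms: a morphism is a class of formal
   composites of chain maps and of inverses of quasi-isomorphisms. There is no
   need to pass to the homotopy category first: inverting the projection of
   each cylinder onto its base identifies homotopic maps. *)
Section DerivedCategory.
Variable R : comPzRingType.
Implicit Types A B V W X Y Z : cpx R.

Inductive zigzag : cpx R -> cpx R -> Type :=
| zz_map X Y (f : cmap X Y) : zigzag X Y
| zz_inv X Y (s : cmap X Y) (s_qi : quasi_iso s) : zigzag Y X
| zz_comp X Y Z (g : zigzag Y Z) (f : zigzag X Y) : zigzag X Z.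

Inductive zz_eq : forall X Y, zigzag X Y -> zigzag X Y -> Prop :=
| zz_refl X Y (f : zigzag X Y) : zz_eq f f
| zz_sym X Y (f g : zigzag X Y) : zz_eq f g -> zz_eq g f
| zz_trans X Y (f g h : zigzag X Y) : zz_eq f g -> zz_eq g h -> zz_eq f h
| zz_cong X Y Z (g g' : zigzag Y Z) (f f' : zigzag X Y) :
    zz_eq g g' -> zz_eq f f' -> zz_eq (zz_comp g f) (zz_comp g' f')
| zz_assoc X Y Z W (h : zigzag Z W) (g : zigzag Y Z) (f : zigzag X Y) :
    zz_eq (zz_comp h (zz_comp g f)) (zz_comp (zz_comp h g) f)
| zz_idl X Y (f : zigzag X Y) : zz_eq (zz_comp (zz_map (cmap_id Y)) f) f
| zz_idr X Y (f : zigzag X Y) : zz_eq (zz_comp f (zz_map (cmap_id X))) f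
| zz_mapM X Y Z (g : cmap Y Z) (f : cmap X Y) :
    zz_eq (zz_comp (zz_map g) (zz_map f)) (zz_map (cmap_comp g f))
| zz_invl X Y (s : cmap X Y) (s_qi : quasi_iso s) :
    zz_eq (zz_comp (zz_inv s_qi) (zz_map s)) (zz_map (cmap_id X))
| zz_invr X Y (s : cmap X Y) (s_qi : quasi_iso s) :
    zz_eq (zz_comp (zz_map s) (zz_inv s_qi)) (zz_map (cmap_id Y)).

Definition Db_hom (X Y : cpx R) : Type :=
  {c : zigzag X Y -> Prop | exists f, c = zz_eq f}.

Definition Db_class X Y (f : zigzag X Y) : Db_hom X Y :=
  exist _ (zz_eq f) (ex_intro _ f erefl).

Definition Db_repr X Y (f : Db_hom X Y) : zigzag X Y := projT1 (cid (projT2 f)).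

Lemma Db_reprK X Y (f : Db_hom X Y) : Db_class (Db_repr f) = f.
Proof.
rewrite /Db_repr; case: f => c cP /=; case: cid => f /= ec.
by case: _ / (esym ec) cP => cP; congr exist; exact: Prop_irrelevance.
Qed.

Lemma Db_classP X Y (f g : zigzag X Y) :
  Db_class f = Db_class g <-> zz_eq f g.
Proof.
split=> [[->]|fg]; first exact: zz_refl.
have e : zz_eq f = zz_eq g.
  apply/funext => h; apply/propext; split; apply: zz_trans => //.
  exact: zz_sym.
by rewrite /Db_class; case: _ / e (ex_intro _ g _) => q; congr exist;
  exact: Prop_irrelevance.
Qed.

Definition Db_map X Y (f : cmap X Y) : Db_hom X Y := Db_class (zz_map f).
Definition Db_inv X Y (s : cmap X Y) (s_qi : quasi_iso s) : Db_hom Y X :=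
  Db_class (zz_inv s_qi).
Definition Db_id X : Db_hom X X := Db_map (cmap_id X).
Definition Db_comp X Y Z (g : Db_hom Y Z) (f : Db_hom X Y) : Db_hom X Z :=
  Db_class (zz_comp (Db_repr g) (Db_repr f)).

Local Notation "g \oD f" := (Db_comp g f) (at level 50, left associativity).

Lemma Db_comp_class X Y Z (g : zigzag Y Z) (f : zigzag X Y) :
  Db_class g \oD Db_class f = Db_class (zz_comp g f).
Proof.
by apply/Db_classP; apply: zz_cong; apply/Db_classP; rewrite Db_reprK.
Qed.

Lemma Db_compA X Y Z W (h : Db_hom Z W) (g : Db_hom Y Z) (f : Db_hom X Y) :
  h \oD (g \oD f) = h \oD g \oD f.
Proof.
rewrite -(Db_reprK h) -(Db_reprK g) -(Db_reprK f) !Db_comp_class.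
exact/Db_classP/zz_assoc.
Qed.

Lemma Db_idl X Y (f : Db_hom X Y) : Db_id Y \oD f = f.
Proof. by rewrite -(Db_reprK f) Db_comp_class; exact/Db_classP/zz_idl. Qed.

Lemma Db_idr X Y (f : Db_hom X Y) : f \oD Db_id X = f.
Proof. by rewrite -(Db_reprK f) Db_comp_class; exact/Db_classP/zz_idr. Qed.

Lemma Db_mapM X Y Z (g : cmap Y Z) (f : cmap X Y) :
  Db_map g \oD Db_map f = Db_map (cmap_comp g f).
Proof. by rewrite Db_comp_class; exact/Db_classP/zz_mapM. Qed.

Lemma Db_invl X Y (s : cmap X Y) (s_qi : quasi_iso s) :
  Db_inv s_qi \oD Db_map s = Db_id X.
Proof. by rewrite Db_comp_class; exact/Db_classP/zz_invl. Qed.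

Lemma Db_invr X Y (s : cmap X Y) (s_qi : quasi_iso s) :
  Db_map s \oD Db_inv s_qi = Db_id Y.
Proof. by rewrite Db_comp_class; exact/Db_classP/zz_invr. Qed.

Lemma Db_ind (P : forall X Y, Db_hom X Y -> Prop) :
  (forall X Y (f : cmap X Y), P X Y (Db_map f)) ->
  (forall X Y (s : cmap X Y) (s_qi : quasi_iso s), P Y X (Db_inv s_qi)) ->
  (forall X Y Z (g : Db_hom Y Z) (f : Db_hom X Y),
     P Y Z g -> P X Y f -> P X Z (g \oD f)) ->
  forall X Y (f : Db_hom X Y), P X Y f.
Proof.
move=> Pmap Pinv Pcomp X Y f; rewrite -(Db_reprK f).
elim: (Db_repr f) => {X Y f} [X Y f|X Y s s_qi|X Y Z g Pg f Pf].
- exact: Pmap.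
- exact: Pinv.
- by rewrite -Db_comp_class; exact: Pcomp.
Qed.

Fixpoint zz_suml A X Y (f : zigzag X Y) : zigzag (cpx_sum X A) (cpx_sum Y A) :=
  match f with
  | zz_map _ _ f => zz_map (cmap_suml A f)
  | zz_inv _ _ s s_qi => zz_inv (cmap_suml_qi A s_qi)
  | zz_comp _ _ _ g f => zz_comp (zz_suml A g) (zz_suml A f)
  end.

Lemma cmap_suml_id A X : cmap_suml A (cmap_id X) = cmap_id (cpx_sum X A).
Proof. by apply: cmap_ext => i [x y]. Qed.

Lemma zz_suml_eq A X Y (f g : zigzag X Y) :
  zz_eq f g -> zz_eq (zz_suml A f) (zz_suml A g).
Proof.
elim=> {X Y f g} [X Y f|X Y f g _ fg|X Y f g h _ fg _ gh
  |X Y Z g g' f f' _ gg _ ff|X Y Z W h g f|X Y f|X Y f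
  |X Y Z g f|X Y s s_qi|X Y s s_qi] /=.
- exact: zz_refl.
- exact: zz_sym.
- exact: zz_trans fg gh.
- exact: zz_cong.
- exact: zz_assoc.
- by rewrite cmap_suml_id; exact: zz_idl.
- by rewrite cmap_suml_id; exact: zz_idr.
- rewrite (_ : cmap_suml A (cmap_comp g f) =
    cmap_comp (cmap_suml A g) (cmap_suml A f)); first exact: zz_mapM.
  by apply: cmap_ext => i [x y].
- by rewrite cmap_suml_id; exact: zz_invl.
- by rewrite cmap_suml_id; exact: zz_invr.
Qed.

Definition Db_suml A X Y (f : Db_hom X Y) :
    Db_hom (cpx_sum X A) (cpx_sum Y A) :=
  Db_class (zz_suml A (Db_repr f)).

Lemma Db_suml_class A X Y (f : zigzag X Y) :
  Db_suml A (Db_class f) = Db_class (zz_suml A f).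
Proof. by apply/Db_classP/zz_suml_eq/Db_classP; rewrite Db_reprK. Qed.

Lemma Db_suml_comp A X Y Z (g : Db_hom Y Z) (f : Db_hom X Y) :
  Db_suml A (g \oD f) = Db_suml A g \oD Db_suml A f.
Proof.
rewrite -(Db_reprK g) -(Db_reprK f) Db_comp_class !Db_suml_class.
by rewrite Db_comp_class.
Qed.

Lemma Db_suml_map A X Y (f : cmap X Y) :
  Db_suml A (Db_map f) = Db_map (cmap_suml A f).
Proof. exact: Db_suml_class. Qed.

Lemma Db_suml_id A X : Db_suml A (Db_id X) = Db_id (cpx_sum X A).
Proof. by rewrite /Db_id Db_suml_map cmap_suml_id. Qed.

Lemma Db_fst_suml A X Y (f : Db_hom X Y) :
  Db_map (cmap_fst Y A) \oD Db_suml A f = f \oD Db_map (cmap_fst X A).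
Proof.
move: X Y f; apply: Db_ind => [X Y f|X Y s s_qi|X Y Z g f Hg Hf].
- by rewrite Db_suml_map !Db_mapM; congr Db_map; apply: cmap_ext.
- have H : Db_map s \oD Db_map (cmap_fst X A) =
      Db_map (cmap_fst Y A) \oD Db_suml A (Db_map s).
    by rewrite Db_suml_map !Db_mapM; congr Db_map; apply: cmap_ext.
  rewrite -[LHS]Db_idl -(Db_invl s_qi) -!Db_compA.
  rewrite [Db_map s \oD _]Db_compA H -Db_compA -Db_suml_comp Db_invr.
  by rewrite Db_suml_id Db_idr.
- by rewrite Db_suml_comp Db_compA Hg -Db_compA Hf Db_compA.
Qed.

Lemma Db_snd_suml A X Y (f : Db_hom X Y) :
  Db_map (cmap_snd Y A) \oD Db_suml A f = Db_map (cmap_snd X A).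
Proof.
move: X Y f; apply: Db_ind => [X Y f|X Y s s_qi|X Y Z g f Hg Hf].
- by rewrite Db_suml_map !Db_mapM; congr Db_map; apply: cmap_ext.
- have H : Db_map (cmap_snd X A) =
      Db_map (cmap_snd Y A) \oD Db_suml A (Db_map s).
    by rewrite Db_suml_map !Db_mapM; congr Db_map; apply: cmap_ext.
  by rewrite H -Db_compA -Db_suml_comp Db_invr Db_suml_id Db_idr.
- by rewrite Db_suml_comp Db_compA Hg Hf.
Qed.

Definition cmap_sumr X A B (f : cmap A B) : cmap (cpx_sum X A) (cpx_sum X B) :=
  cmap_pair (cmap_fst X A) (cmap_comp f (cmap_snd X A)).

Lemma Db_suml_sumr A B X Y (f : cmap A B) (g : Db_hom X Y) :
  Db_map (cmap_sumr Y f) \oD Db_suml A g =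
  Db_suml B g \oD Db_map (cmap_sumr X f).
Proof.
move: X Y g; apply: Db_ind => [X Y g|X Y s s_qi|X Y Z h g Hh Hg].
- by rewrite !Db_suml_map !Db_mapM; congr Db_map; apply: cmap_ext.
- have H : Db_suml B (Db_map s) \oD Db_map (cmap_sumr X f) =
      Db_map (cmap_sumr Y f) \oD Db_suml A (Db_map s).
    by rewrite !Db_suml_map !Db_mapM; congr Db_map; apply: cmap_ext.
  rewrite -[LHS]Db_idl -Db_suml_id -(Db_invl s_qi) Db_suml_comp -!Db_compA.
  rewrite [Db_suml B (Db_map s) \oD _]Db_compA H -Db_compA -Db_suml_comp.
  by rewrite Db_invr Db_suml_id Db_idr.
- by rewrite !Db_suml_comp Db_compA Hh -!Db_compA Hg.
Qed.

Definition cmap_diag X : cmap X (cpx_sum X X) :=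
  cmap_pair (cmap_id X) (cmap_id X).

(* The morphism into cpx_sum X Y with components f and g. *)
Definition Db_pair Z X Y (f : Db_hom Z X) (g : Db_hom Z Y) :
    Db_hom Z (cpx_sum X Y) :=
  Db_suml Y f \oD Db_map (cmap_swap Y Z) \oD Db_suml Z g \oD
  Db_map (cmap_diag Z).

Lemma Db_fst_pair Z X Y (f : Db_hom Z X) (g : Db_hom Z Y) :
  Db_map (cmap_fst X Y) \oD Db_pair f g = f.
Proof.
rewrite /Db_pair !Db_compA Db_fst_suml -[f \oD _ \oD _]Db_compA Db_mapM.
rewrite (_ : cmap_comp _ _ = cmap_snd Y Z); last by apply: cmap_ext.
rewrite -2!Db_compA [Db_map _ \oD _]Db_compA Db_snd_suml Db_mapM.
rewrite (_ : cmap_comp _ _ = cmap_id Z); last by apply: cmap_ext.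
exact: Db_idr.
Qed.

Lemma Db_snd_pair Z X Y (f : Db_hom Z X) (g : Db_hom Z Y) :
  Db_map (cmap_snd X Y) \oD Db_pair f g = g.
Proof.
rewrite /Db_pair !Db_compA Db_snd_suml Db_mapM.
rewrite (_ : cmap_comp _ _ = cmap_fst Y Z); last by apply: cmap_ext.
rewrite Db_fst_suml -Db_compA Db_mapM.
rewrite (_ : cmap_comp _ _ = cmap_id Z); last by apply: cmap_ext.
exact: Db_idr.
Qed.

Lemma Db_pair_map W Z X Y (f : Db_hom Z X) (g : Db_hom Z Y) (k : cmap W Z) :
  Db_pair f g \oD Db_map k = Db_pair (f \oD Db_map k) (g \oD Db_map k).
Proof.
rewrite /Db_pair !Db_suml_comp !Db_suml_map.
rewrite -!Db_compA Db_mapM; congr (_ \oD _).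
rewrite (_ : cmap_comp _ _ = cmap_comp (cmap_sumr Z k)
  (cmap_comp (cmap_suml W k) (cmap_diag W))); last by apply: cmap_ext.
rewrite -Db_mapM [Db_suml Z g \oD _]Db_compA -Db_suml_sumr -!Db_compA.
rewrite [LHS]Db_compA [RHS]Db_compA !Db_mapM; congr (_ \oD _).
by congr Db_map; apply: cmap_ext.
Qed.

Lemma Db_pair_comp W Z X Y (f : Db_hom Z X) (g : Db_hom Z Y) (k : Db_hom W Z) :
  Db_pair f g \oD k = Db_pair (f \oD k) (g \oD k).
Proof.
move: W Z k f g.
apply: (@Db_ind (fun W Z k => forall (f : Db_hom Z X) (g : Db_hom Z Y), _)).
- by move=> W Z k f g; exact: Db_pair_map.
- move=> Z W s s_qi f g.
  rewrite -[RHS]Db_idr -(Db_invr s_qi) Db_compA Db_pair_map.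
  by rewrite -!Db_compA Db_invl !Db_idr.
- by move=> W V Z h k Hh Hk f g; rewrite Db_compA Hh Hk !Db_compA.
Qed.

Lemma Db_pair_eta Z X Y (h : Db_hom Z (cpx_sum X Y)) :
  Db_pair (Db_map (cmap_fst X Y) \oD h) (Db_map (cmap_snd X Y) \oD h) = h.
Proof.
rewrite -Db_pair_comp -[RHS]Db_idl; congr (_ \oD _).
rewrite /Db_pair !Db_suml_map !Db_mapM; congr Db_map.
by apply: cmap_ext => i [].
Qed.

(* The addition of morphisms forced by the existence of direct sums. *)
Definition Db_add X Y (f g : Db_hom X Y) : Db_hom X Y :=
  Db_map (cmap_codiag Y) \oD Db_pair f g.
Definition Db_zero X Y : Db_hom X Y := Db_map (cmap_zero X Y).
Definition Db_opp X Y (f : Db_hom X Y) : Db_hom X Y :=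
  Db_map (cmap_opp (cmap_id Y)) \oD f.

Lemma Db_compDl X Y Z (f g : Db_hom Y Z) (k : Db_hom X Y) :
  Db_add f g \oD k = Db_add (f \oD k) (g \oD k).
Proof. by rewrite /Db_add -Db_compA Db_pair_comp. Qed.

Lemma Db_add_map X Y (f g : cmap X Y) :
  Db_add (Db_map f) (Db_map g) = Db_map (cmap_add f g).
Proof.
rewrite /Db_add /Db_pair !Db_suml_map !Db_mapM; congr Db_map.
by apply: cmap_ext.
Qed.

Lemma Db_addE X Y (f g : Db_hom X Y) : Db_add f g =
  Db_add (Db_map (cmap_fst Y Y)) (Db_map (cmap_snd Y Y)) \oD Db_pair f g.
Proof. by rewrite Db_compDl Db_fst_pair Db_snd_pair. Qed.

Lemma Db_compDr_map X Y Z (k : cmap Y Z) (f g : Db_hom X Y) :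
  Db_map k \oD Db_add f g = Db_add (Db_map k \oD f) (Db_map k \oD g).
Proof.
rewrite [in LHS]Db_addE Db_add_map Db_compA Db_mapM.
rewrite (_ : cmap_comp _ _ = cmap_add (cmap_comp k (cmap_fst Y Y))
   (cmap_comp k (cmap_snd Y Y))); last first.
  by apply: cmap_ext => i x; rewrite /= linearD.
by rewrite -Db_add_map Db_compDl -!Db_mapM -!Db_compA Db_fst_pair Db_snd_pair.
Qed.

Lemma Db_compDr X Y Z (k : Db_hom Y Z) (f g : Db_hom X Y) :
  k \oD Db_add f g = Db_add (k \oD f) (k \oD g).
Proof.
move: Y Z k f g.
apply: (@Db_ind (fun Y Z k => forall f g : Db_hom X Y, _)).
- by move=> Y Z k f g; exact: Db_compDr_map.
- move=> Y Z s s_qi f g.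
  rewrite -{1}[f]Db_idl -{1}[g]Db_idl -(Db_invr s_qi) -!Db_compA.
  by rewrite -Db_compDr_map Db_compA Db_invl Db_idl.
- by move=> Y Z V h k Hh Hk f g; rewrite -Db_compA Hk Hh !Db_compA.
Qed.

Lemma Db_comp0 X Y Z (f : Db_hom X Y) : Db_zero Y Z \oD f = Db_zero X Z.
Proof.
move: X Y f; apply: Db_ind => [X Y f|X Y s s_qi|X Y V g f Hg Hf].
- rewrite /Db_zero Db_mapM; congr Db_map; apply: cmap_ext => i x.
  by [].
- have H : Db_zero X Z = Db_zero Y Z \oD Db_map s.
    by rewrite /Db_zero Db_mapM; congr Db_map; apply: cmap_ext.
  by rewrite H -Db_compA Db_invr Db_idr.
- by rewrite Db_compA Hg Hf.
Qed.

Lemma Db_addC X Y : commutative (@Db_add X Y).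
Proof.
move=> f g; have -> : Db_add g f =
    Db_add (Db_map (cmap_snd Y Y)) (Db_map (cmap_fst Y Y)) \oD Db_pair f g.
  by rewrite Db_compDl Db_fst_pair Db_snd_pair.
rewrite Db_addE !Db_add_map; congr (Db_map _ \oD _).
by apply: cmap_ext => i x; exact: addrC.
Qed.

Lemma Db_addA X Y : associative (@Db_add X Y).
Proof.
move=> f g h; pose gh := Db_pair g h; pose q := Db_pair f gh.
have ef : f = Db_map (cmap_fst _ _) \oD q by rewrite Db_fst_pair.
have eg : g = Db_map (cmap_comp (cmap_fst _ _) (cmap_snd _ _)) \oD q.
  by rewrite -Db_mapM -Db_compA Db_snd_pair Db_fst_pair.
have eh : h = Db_map (cmap_comp (cmap_snd _ _) (cmap_snd _ _)) \oD q.
  by rewrite -Db_mapM -Db_compA !Db_snd_pair.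
rewrite {}ef {}eg {}eh -!Db_compDl !Db_add_map; congr (Db_map _ \oD _).
by apply: cmap_ext => i x; exact: addrA.
Qed.

Lemma Db_add0 X Y : left_id (Db_zero X Y) (@Db_add X Y).
Proof.
move=> f; rewrite -(Db_comp0 Y f) -{2}[f]Db_idl -Db_compDl Db_add_map.
rewrite (_ : cmap_add _ _ = cmap_id Y) ?Db_idl //.
by apply: cmap_ext => i x; exact: add0r.
Qed.

Lemma Db_addN X Y : left_inverse (Db_zero X Y) (@Db_opp X Y) (@Db_add X Y).
Proof.
move=> f; rewrite /Db_opp -{2}[f]Db_idl -Db_compDl Db_add_map.
rewrite (_ : cmap_add _ _ = cmap_zero Y Y) ?Db_comp0 //.
by apply: cmap_ext => i x; exact: addNr.
Qed.

End DerivedCategory.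

(* MathComp's pzRingType cannot hold the endomorphism rings of the derived
   category: their carriers quantify over all complexes, hence live in a
   universe strictly above the one of modules, and the carriers of rings are
   constrained to be modules. *)
Record ring_on (T : Type) := RingOn {
  ro_zero : T;
  ro_one : T;
  ro_opp : T -> T;
  ro_add : T -> T -> T;
  ro_mul : T -> T -> T;
  ro_addA : associative ro_add;
  ro_addC : commutative ro_add;
  ro_add0 : left_id ro_zero ro_add;
  ro_addN : left_inverse ro_zero ro_opp ro_add;
  ro_mulA : associative ro_mul;
  ro_mul1l : left_id ro_one ro_mul;
  ro_mul1r : right_id ro_one ro_mul;
  ro_mulDl : left_distributive ro_mul ro_add;
  ro_mulDr : right_distributive ro_mul ro_add
}.

Definition ring_commutative T (A : ring_on T) : Prop := commutative (ro_mul A).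

Definition ring_isomorphism T T' (A : ring_on T) (B : ring_on T')
    (phi : T -> T') : Prop :=
  [/\ bijective phi, phi (ro_one A) = ro_one B,
      {morph phi : x y / ro_add A x y >-> ro_add B x y} &
      {morph phi : x y / ro_mul A x y >-> ro_mul B x y}].

Definition Db_end (R : comPzRingType) (X : cpx R) : ring_on (Db_hom X X) :=
  @RingOn _ (Db_zero X X) (Db_id X) (@Db_opp R X X) (@Db_add R X X)
    (@Db_comp R X X X) (@Db_addA R X X) (@Db_addC R X X) (@Db_add0 R X X)
    (@Db_addN R X X) (@Db_compA R X X X X) (@Db_idl R X X) (@Db_idr R X X)
    (fun f g k => Db_compDl f g k) (fun k f g => Db_compDr k f g).

Program Definition mod_end (R : comPzRingType) (M : lmodType R) :
    ring_on {linear M -> M} :=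
  @RingOn _ (lin_zero M M) (lin_id M) (@lin_opp R M M) (@lin_add R M M)
    (@lin_comp R M M M) _ _ _ _ _ _ _ _ _.
Next Obligation. by move=> *; apply: linear_ext => x; exact: addrA. Qed.
Next Obligation. by move=> *; apply: linear_ext => x; exact: addrC. Qed.
Next Obligation. by move=> *; apply: linear_ext => x; exact: add0r. Qed.
Next Obligation. by move=> *; apply: linear_ext => x; exact: addNr. Qed.
Next Obligation. by move=> *; apply: linear_ext. Qed.
Next Obligation. by move=> *; apply: linear_ext. Qed.
Next Obligation. by move=> *; apply: linear_ext. Qed.
Next Obligation. by move=> *; apply: linear_ext. Qed.
Next Obligation.
by move=> *; apply: linear_ext => x; exact: linearD.
Qed.

Section TwoTermComplex.
Variables (R U : comPzRingType) (u : {rmorphism R -> U}).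

(* R in degree -1 = Negz 0, U in degree 0. *)
Definition K_ob (i : int) : lmodType R :=
  match i with
  | Negz 0 => R^o
  | Posz 0 => restr u
  | _ => 'rV[R]_0
  end.

Definition K_d (i j : int) : {linear K_ob i -> K_ob j} :=
  match i, j with
  | Negz 0, Posz 0 => restr_map u
  | _, _ => lin_zero _ _
  end.

Lemma K_shape i j x : j != i + 1 -> K_d i j x = 0.
Proof. by case: i x => -[|n] //; case: j => -[|m]. Qed.

Lemma K_dd i j k x : K_d j k (K_d i j x) = 0.
Proof.
by case: i x => -[|n] x; case: j => -[|m] /=; rewrite ?linear0 //;
  case: k => -[|l].
Qed.

Lemma K_bounded : exists n : nat, forall i (x : K_ob i), (n < `|i|)%N -> x = 0.
Proof. by exists 1%N; case=> -[|n] //= x _; exact: thinmx0. Qed.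

Definition K_cpx : cpx R := Cpx K_shape K_dd K_bounded.

End TwoTermComplex.

(* Main.v *)
Require Import Defs.
From mathcomp Require Import all_boot all_order all_algebra.
From mathcomp Require Import boolp classical_sets.
Set Implicit Arguments.
Unset Strict Implicit.
Unset Printing Implicit Defensive.
Import GRing.Theory.
Local Open Scope ring_scope.

(** Write [K] for the complex [R -> U] and [L = K[-1]], with its projection
    [L -> R] in the derived category. The conditions on [u] say that the cone
    [U (x) L] of the projection [L (x) L -> L] on one factor has no cohomology
    in nonnegative degrees, where [L] lives; hence composition with this
    projection embeds Hom(L, L) into Hom(L (x) L, L). The projections on the two
    factors coincide, because [U] is commutative. So [L] behaves like the unit
    of a tensor category, and endomorphisms of a unit commute.

    The proof makes this argument explicit and uses no derived tensor products.
    Let [p : F -> U] be the free module on the set [U], and [N] the pullback of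
    [u] along [p], with projections [b : N -> R] and [d : N -> F]. The complex
    [K' = (d : N -> F)] is quasi-isomorphic to [K]. As [F] is free, every
    endomorphism of [K] in the derived category comes from a chain endomorphism
    of [K'] ([Db_end_repr]); although bounded complexes have no bounded
    projective resolutions in general, a resolution up to degree [0] is enough
    after truncating the complexes of a zigzag ([trunc_point]). Moreover a chain
    map from [K'] to [K] is zero in the derived category once its component
    [N -> R] factors through [d], since a linear map [F -> U] that vanishes on
    the image of [N] is zero ([pb_free_epi]).

    It remains to see that, for chain endomorphisms [f] and [g] of [K'], the map
    [theta = b f g - b g f] on [N] factors through [d]. Call a bilinear map on
    [N] null if it has the form [h(n, d m) + k(d n, m)]. The symmetry of the
    multiplication of [U] makes [b(m) n - b(n) m] null ([base_swap_null]), and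
    three applications of this fact make [b(m) theta(n)] null
    ([chain_endo_comm]). The vanishing of cohomology mentioned above becomes
    [base_form_factor]: if [b(m) theta(n)] is null, then [theta] factors
    through [d]. It rests on the bijectivity of [N (x) U -> F (x) U]
    ([pb_tens_bij]), the only place where [Tor1] enters.

    If [u] is injective, then [K] is quasi-isomorphic to [U/R] in degree [0].
    An endomorphism of [U/R] thereby gives one of [K]. Cohomology in degree [0]
    shows that this assignment is injective; it is surjective because a chain
    map from [K'] to [U/R] is a linear map on [F] that factors through [U/R]. *)

Local Notation "g \oD f" := (Db_comp g f) (at level 50, left associativity).

(** * Linear maps, kernels and tensor products *)

Section LinearAlgebra.
Variable R : comPzRingType.
Implicit Types (A B C M N P : lmodType R).

(** Two values of the submodule [G] at the same point differ by a value at [0],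
    so that any choice of values is linear. *)
Lemma linear_of_graph A B (G : A -> B -> Prop) :
  (forall a x y x' y', G x y -> G x' y' -> G (a *: x + x') (a *: y + y')) ->
  (forall x, exists y, G x y) ->
  (forall y, G 0 y -> y = 0) ->
  exists f : {linear A -> B}, forall x, G x (f x).
Proof.
move=> Glin Gtot G0; have [f fG] := choice Gtot.
have Gfun x y y' : G x y -> G x y' -> y = y'.
  move=> xy xy'; apply/eqP; rewrite -subr_eq0; apply/eqP/G0.
  have := Glin (-1) x y' x y xy' xy.
  by rewrite !scaleN1r addNr addrC.
have f_lin : linear f.
  move=> a x y; apply: Gfun (fG _) _; exact: Glin.
by exists (mklin f_lin).
Qed.

Lemma factor_through_surj A B C (g : {linear A -> B}) (f : {linear A -> C}) :
  (forall y, exists x, g x = y) -> (forall x, g x = 0 -> f x = 0) ->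
  exists h : {linear B -> C}, forall x, h (g x) = f x.
Proof.
move=> gsurj gker.
have [||z [x [gx <-]]|h hG] :=
    @linear_of_graph B C (fun y z => exists x, g x = y /\ f x = z).
- move=> a _ _ _ _ [x [<- <-]] [x' [<- <-]].
  by exists (a *: x + x'); rewrite !linearP.
- by move=> y; have [x <-] := gsurj y; exists (f x), x.
- exact: gker.
exists h => x; have [x' [gx' <-]] := hG (g x).
apply/eqP; rewrite -subr_eq0 -linearB gker //.
by rewrite linearB gx' subrr.
Qed.

Lemma ker_lift_sub A B C (g : {linear B -> C}) (f : {linear A -> B})
  (gf0 : forall x, g (f x) = 0) x : f x \in Defs.lker g.
Proof. by rewrite inE gf0. Qed.

Lemma ker_lift_linear A B C (g : {linear B -> C}) (f : {linear A -> B})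
  (gf0 : forall x, g (f x) = 0) :
  linear (fun x => Kermod (g := g) (ker_lift_sub gf0 x) : kermod g).
Proof. by move=> a x y; apply: val_inj; rewrite /= linearP. Qed.

Definition ker_lift A B C (g : {linear B -> C}) (f : {linear A -> B})
  (gf0 : forall x, g (f x) = 0) : {linear A -> kermod g} :=
  mklin (ker_lift_linear gf0).

Lemma ker_incl_inj A B (g : {linear A -> B}) : injective (ker_incl g).
Proof. exact: val_inj. Qed.

Lemma tens0l M N (n : N) : tens (0 : M) n = 0.
Proof. by rewrite -[0 in LHS](scale0r (0 : M)) tensZl scale0r. Qed.

Lemma tens0r M N (m : M) : tens m (0 : N) = 0.
Proof. by rewrite -[0 in LHS](scale0r (0 : N)) tensZr scale0r. Qed.

Lemma tensNl M N (m : M) (n : N) : tens (- m) n = - tens m n.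
Proof. by rewrite -!scaleN1r tensZl. Qed.

Lemma tensNr M N (m : M) (n : N) : tens m (- n) = - tens m n.
Proof. by rewrite -!scaleN1r tensZr. Qed.

Lemma tensBl M N (m m' : M) (n : N) : tens (m - m') n = tens m n - tens m' n.
Proof. by rewrite tensDl tensNl. Qed.

Lemma tensBr M N (m : M) (n n' : N) : tens m (n - n') = tens m n - tens m n'.
Proof. by rewrite tensDr tensNr. Qed.

Lemma exists_tensor_lift M N P (b : M -> N -> P) :
  (forall m m' n, b (m + m') n = b m n + b m' n) ->
  (forall m n n', b m (n + n') = b m n + b m n') ->
  (forall a m n, b (a *: m) n = a *: b m n) ->
  (forall a m n, b m (a *: n) = a *: b m n) ->
  exists h : {linear tensor M N -> P}, forall m n, h (tens m n) = b m n.
Proof.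
move=> bDl bDr bZl bZr; exists (tensor_lift bDl bDr bZl bZr) => m n.
exact: tensor_liftE.
Qed.

Lemma tens_ind M N (Q : tensor M N -> Prop) :
  (forall m n, Q (tens m n)) -> (forall s t, Q s -> Q t -> Q (s + t)) ->
  forall t, Q t.
Proof.
move=> Qt QD t; elim/quotmod_ind: t => t; have [s ->] := free_decomp t.
elim: s (free_coef t) => [|[m n] s ih] c.
  by rewrite big_nil linear0 -(tens0l M (0 : N)).
rewrite big_cons linearD linearZ /=; apply: QD (ih c).
by have := Qt (c (m, n) *: m) n; rewrite tensZl.
Qed.

Lemma tensor_swap M N :
  exists h : {linear tensor M N -> tensor N M},
    forall x y, h (tens x y) = tens y x.
Proof.
apply: exists_tensor_lift => [m m' n|m n n'|a m n|a m n].
- by rewrite tensDr.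
- by rewrite tensDl.
- by rewrite tensZr.
- by rewrite tensZl.
Qed.

Lemma tensor_map_surj M N M' N' (f : {linear M -> M'}) (g : {linear N -> N'}) :
  (forall y, exists x, f x = y) -> (forall y, exists x, g x = y) ->
  forall t, exists s, tensor_map f g s = t.
Proof.
move=> fs gs; apply: tens_ind => [m n|s t [s' <-] [t' <-]].
  have [[x <-] [y <-]] := (fs m, gs n).
  by exists (tens x y); rewrite tensor_mapE.
by exists (s' + t'); rewrite linearD.
Qed.

(** Right exactness of the tensor product, in both variables at once. In the
    quotient of [tensor M N] by the span, the class of [tens m n] depends only
    on [f m] and [g n]; hence the quotient receives a map from [tensor M' N']
    whose composite with [tensor_map f g] is the projection. *)
Lemma tensor_map_ker M N M' N' (f : {linear M -> M'}) (g : {linear N -> N'}) :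
  (forall y, exists x, f x = y) -> (forall y, exists x, g x = y) ->
  forall t, tensor_map f g t = 0 ->
  Defs.span (fun s => exists m n, s = tens m n /\ (f m = 0 \/ g n = 0)) t.
Proof.
move=> fs gs; set S := (X in Defs.span X).
pose q : {linear _ -> quotmod S} := quotmod_pi S.
have [f' fK] := choice fs; have [g' gK] := choice gs.
have q0 m n : f m = 0 \/ g n = 0 -> q (tens m n) = 0.
  move=> mn; rewrite -(linear0 q); apply/quotmod_eqP; rewrite subr0.
  by apply: span_gen; exists m, n.
have eqq m m' n n' : f m = f m' -> g n = g n' ->
    q (tens m n) = q (tens m' n').
  move=> ff gg; apply/eqP; rewrite -subr_eq0 -linearB.
  rewrite (_ : _ - _ = tens (m - m') n + tens m' (n - n')).
    rewrite linearD !q0 ?addr0 //.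
      by right; rewrite linearB gg subrr.
    by left; rewrite linearB ff subrr.
  by rewrite tensBl tensBr addrA subrK.
have [h hE] : exists h : {linear tensor M' N' -> quotmod S},
    forall m n, h (tens m n) = q (tens (f' m) (g' n)).
  apply: (exists_tensor_lift (b := fun m n => q (tens (f' m) (g' n)))).
  - move=> m m' n; rewrite -linearD -tensDl; apply: eqq => //.
    by rewrite linearD !fK.
  - move=> m n n'; rewrite -linearD -tensDr; apply: eqq => //.
    by rewrite linearD !gK.
  - move=> a m n; rewrite -linearZZ -tensZl; apply: eqq => //.
    by rewrite linearZZ !fK.
  - move=> a m n; rewrite -linearZZ -tensZr; apply: eqq => //.
    by rewrite linearZZ !gK.
have hq : lin_comp h (tensor_map f g) =1 q.
  apply: tensor_ext => m n; rewrite -[LHS]/(h (tensor_map f g (tens m n))).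
  rewrite tensor_mapE hE.
  by apply: eqq; rewrite ?fK ?gK.
move=> t t0; have := hq t.
rewrite -[lin_comp _ _ t]/(h (tensor_map f g t)) t0 linear0 => /esym.
by rewrite -(linear0 q) => /quotmod_eqP; rewrite subr0.
Qed.

Lemma tensor_ker_l M N M' (f : {linear M -> M'}) :
  (forall y, exists x, f x = y) -> forall t, tensor_map f (lin_id N) t = 0 ->
  exists s, tensor_map (ker_incl f) (lin_id N) s = t.
Proof.
move=> fs t t0; have gs : forall y : N, exists x, lin_id N x = y.
  by move=> y; exists y.
elim: (tensor_map_ker fs gs t0) => {t t0 gs} [|_ [m [n [-> [/eqP fm|n0]]]]
  |_ _ _ [x <-] _ [y <-]|a _ _ [x <-]].
- by exists 0; rewrite linear0.
- by exists (tens (Kermod fm : kermod f) n); rewrite tensor_mapE.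
- by exists 0; rewrite linear0 [n](n0 : n = 0) tens0r.
- by exists (x + y); rewrite linearD.
- by exists (a *: x); rewrite linearZ.
Qed.

Lemma tensor_ker_r M N N' (g : {linear N -> N'}) :
  (forall y, exists x, g x = y) -> forall t, tensor_map (lin_id M) g t = 0 ->
  exists s, tensor_map (lin_id M) (ker_incl g) s = t.
Proof.
move=> gs t t0; have fs : forall y : M, exists x, lin_id M x = y.
  by move=> y; exists y.
elim: (tensor_map_ker fs gs t0) => {t t0 fs} [|_ [m [n [-> [m0|/eqP gn]]]]
  |_ _ _ [x <-] _ [y <-]|a _ _ [x <-]].
- by exists 0; rewrite linear0.
- by exists 0; rewrite linear0 [m](m0 : m = 0) tens0l.
- by exists (tens m (Kermod gn : kermod g)); rewrite tensor_mapE.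
- by exists (x + y); rewrite linearD.
- by exists (a *: x); rewrite linearZ.
Qed.

(** Flatness of free modules: the coefficient maps from [freemod R X (x) N] to
    [N], one for each element of the basis [X], commute with [g] and together
    determine an element of [freemod R X (x) N]. *)
Lemma free_flat (X : choiceType) N N' (g : {linear N -> N'}) :
  injective g -> injective (tensor_map (lin_id (freemod R X)) g).
Proof.
move=> g_inj.
have coefP P (x : X) : exists c : {linear tensor (freemod R X) P -> P},
    forall (f : freemod R X) n, c (tens f n) = (f x : R) *: n.
  apply: (@exists_tensor_lift (freemod R X) _ _
    (fun f n => (f x : R) *: n)) => /=.
  - by move=> f f' n; rewrite -scalerDl.
  - by move=> f n n'; rewrite scalerDr.
  - by move=> a f n; rewrite scalerA.
  - by move=> a f n; rewrite !scalerA mulrC.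
have [c cE] := choice (coefP N); have [c' cE'] := choice (coefP N').
have decomp t : exists s : seq X, forall s', uniq s' -> {subset s <= s'} ->
    t = \sum_(x <- s') tens (free_gen R x) (c x t).
  elim/tens_ind: t => [f n|t t' [s sP] [s' sP']].
    have [s us fs] := free_supp f; exists s => s' us' ss'.
    have -> : \sum_(x <- s') tens (free_gen R x) (c x (tens f n)) =
        tens (\sum_(x <- s') (f x : R) *: free_gen R x) n.
      elim: (s') => [|x r ih]; first by rewrite !big_nil tens0l.
      by rewrite !big_cons ih tensDl cE tensZr tensZl.
    congr tens; apply: val_inj; apply: funext => y /=.
    have -> : val (\sum_(x <- s') (f x : R) *: free_gen R x) y =
        \sum_(x <- s') f x * (x == y)%:R.
      elim: (s') => [|x r ih]; first by rewrite !big_nil.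
      by rewrite !big_cons -ih.
    have [ys|ys] := boolP (y \in s').
      rewrite (bigD1_seq y) //= eqxx mulr1 big1 ?addr0 // => x /negPf->.
      by rewrite mulr0.
    rewrite big_seq big1 => [|x xs].
      by apply/eqP; apply: contraNT ys => /fs/ss'.
    by case: eqP xs ys => [-> ->|_]; rewrite ?mulr0.
  exists (s ++ s') => r ur sr; rewrite {1}(sP r) // => [|x xs]; last first.
    by apply: sr; rewrite mem_cat xs.
  rewrite {1}(sP' r) // => [|x xs]; last first.
    by apply: sr; rewrite mem_cat xs orbT.
  by rewrite -big_split; apply: eq_bigr => x _; rewrite linearD tensDr.
suff inj0 t : tensor_map (lin_id (freemod R X)) g t = 0 -> t = 0.
  move=> t t' tt'; apply/eqP; rewrite -subr_eq0; apply/eqP/inj0.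
  by rewrite linearB tt' subrr.
move=> t0; have [s sP] := decomp t.
rewrite (sP (undup s) (undup_uniq s)) => [|x]; last by rewrite mem_undup.
rewrite big1 // => x _.
have -> : c x t = 0; last by rewrite tens0r.
apply: g_inj; rewrite linear0.
have -> : g (c x t) = c' x (tensor_map (lin_id (freemod R X)) g t).
  suff H : lin_comp g (c x) =1 lin_comp (c' x) (tensor_map (lin_id _) g).
    exact: H.
  apply: tensor_ext => f n; rewrite -[LHS]/(g (c x (tens f n))).
    rewrite -[RHS]/(c' x (tensor_map (lin_id _) g (tens f n))).
    by rewrite tensor_mapE cE cE' linearZ.
by rewrite t0 linear0.
Qed.

End LinearAlgebra.

(** * The partial resolution of the two-term complex *)

(** An element of [syzygy M (x) N] lifts to a cycle of the complex that computes
    [Tor1 M N]; this cycle is a boundary, and boundaries vanish in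
    [syzygy M (x) N]. *)
Lemma Tor1_vanish_inj (R : comPzRingType) (M N : lmodType R) :
  (forall t : Tor1 M N, t = 0) ->
  injective (tensor_map (ker_incl (free_cover M)) (lin_id N)).
Proof.
move=> Tor0.
have cover_surj (P : lmodType R) (y : P) : exists x, free_cover P x = y.
  by exists (free_gen R y); rewrite free_liftE.
suff inj0 t : tensor_map (ker_incl (free_cover M)) (lin_id N) t = 0 -> t = 0.
  move=> t t' tt'; apply/eqP; rewrite -subr_eq0; apply/eqP/inj0.
  by rewrite linearB tt' subrr.
have mapM (A B C : lmodType R) (g : {linear B -> C}) (f : {linear A -> B}) s :
    tensor_map (lin_comp g f) (lin_id N) s =
    tensor_map g (lin_id N) (tensor_map f (lin_id N) s).
  suff H : tensor_map (lin_comp g f) (lin_id N) =1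
    lin_comp (tensor_map g (lin_id N)) (tensor_map f (lin_id N)) by exact: H.
  apply: tensor_ext => m n; rewrite tensor_mapE.
  rewrite -[RHS]/(tensor_map g _ (tensor_map f (lin_id N) (tens m n))).
  by rewrite !tensor_mapE.
have id_surj (y : N) : exists x, lin_id N x = y by exists y.
have [s <-] := tensor_map_surj (cover_surj (syzygy M)) id_surj t.
rewrite -mapM => ds0.
pose c : kermod (tensor_map (res_diff M) (lin_id N)) :=
  Kermod (g := tensor_map (res_diff M) (lin_id N)) (introT eqP ds0).
have /quotmod_pi0P c_bound := Tor0 (quotmod_pi _ c).
have [y sy] : exists y, val c =
    tensor_map (res_diff (syzygy M)) (lin_id N) y.
  elim: c_bound => {c ds0} [|//|x y _ [x' xx'] _ [y' yy']|a x _ [x' xx']].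
  - by exists 0; rewrite !linear0.
  - by exists (x' + y'); rewrite [RHS]linearD -xx' -yy'.
  - by exists (a *: x'); rewrite [RHS]linearZZ -xx'.
rewrite -[s]/(val c) sy /res_diff -mapM.
elim/tens_ind: y {sy} => [f n|y y' y0 y'0]; last first.
  by rewrite linearD y0 y'0 addr0.
rewrite tensor_mapE.
rewrite -[X in tens X _]/(free_cover _ (ker_incl _ (free_cover _ f))).
by rewrite kermodP tens0l.
Qed.

Section PartialResolution.
Variables (R U : comPzRingType) (u : {rmorphism R -> U}).

Let E : lmodType R := restr u.

Definition cover : lmodType R := freemod R E.
Definition cover_pi : {linear cover -> E} := free_cover E.

Definition pullback_eqn : {linear (R^o * cover)%type -> E} :=
  lin_add (lin_comp (restr_map u) (lin_fst R^o cover))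
          (lin_opp (lin_comp cover_pi (lin_snd R^o cover))).

(** The pullback of [u] along [cover_pi]. The complex
    [pb_free : pullback -> cover] is quasi-isomorphic to [R -> U] and has a free
    module in degree [0]. *)
Definition pullback : lmodType R := kermod pullback_eqn.
Definition pb_base : {linear pullback -> R^o} :=
  lin_comp (lin_fst R^o cover) (ker_incl pullback_eqn).
Definition pb_free : {linear pullback -> cover} :=
  lin_comp (lin_snd R^o cover) (ker_incl pullback_eqn).

Lemma pbP (n : pullback) : restr_map u (pb_base n) = cover_pi (pb_free n).
Proof. by apply: subr0_eq; exact: (kermodP n). Qed.

Lemma pb_ext (n m : pullback) :
  pb_base n = pb_base m -> pb_free n = pb_free m -> n = m.
Proof.
move=> b f; apply: ker_incl_inj.
rewrite [LHS]surjective_pairing [RHS]surjective_pairing.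
exact: f_equal2 b f.
Qed.

Lemma pb_lift (A : lmodType R) (b : {linear A -> R^o})
    (f : {linear A -> cover}) :
  (forall x, restr_map u (b x) = cover_pi (f x)) ->
  exists h : {linear A -> pullback},
    forall x, pb_base (h x) = b x /\ pb_free (h x) = f x.
Proof.
move=> bf; have bf0 x : pullback_eqn (lin_pair b f x) = 0.
  by rewrite -[LHS]/(restr_map u (b x) - cover_pi (f x)) bf subrr.
by exists (ker_lift bf0) => x; split; reflexivity.
Qed.

Lemma cover_pi_gen (x : U) : cover_pi (free_gen R (x : E)) = x.
Proof. exact: free_liftE. Qed.

Lemma cover_pi_surj (y : E) : exists x, cover_pi x = y.
Proof. by exists (free_gen R y); exact: cover_pi_gen. Qed.

Lemma pb_point r (x : cover) : restr_map u r = cover_pi x ->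
  exists n : pullback, pb_base n = r /\ pb_free n = x.
Proof.
move=> rx; have rx0 : pullback_eqn (r, x) == 0.
  by rewrite -[pullback_eqn _]/(restr_map u r - cover_pi x) rx subrr.
by exists (Kermod (g := pullback_eqn) rx0); split; reflexivity.
Qed.

Lemma pb_syz : exists j : {linear kermod cover_pi -> pullback},
  forall z, pb_base (j z) = 0 /\ pb_free (j z) = ker_incl cover_pi z.
Proof.
apply: (@pb_lift _ (lin_zero _ _) (ker_incl cover_pi)) => z.
by rewrite linear0 kermodP.
Qed.

Definition unit_gen : cover := free_gen R (1 : U).

Lemma pb_unit : exists n : pullback, pb_base n = 1 /\ pb_free n = unit_gen.
Proof. by apply: pb_point; rewrite cover_pi_gen mklinE rmorph1. Qed.

Lemma restr_mulE (x y : E) : restr_mul u (tens x y) = (x : U) * (y : U).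
Proof. exact: tensor_liftE. Qed.

Hypothesis u_epi : ring_epi u.

Lemma epi_tens (x y : U) :
  tens (x : E) (y : E) = tens ((1 : U) : E) ((x * y : U) : E).
Proof. by apply: (bij_inj u_epi); rewrite !restr_mulE mul1r. Qed.

(** The map [f] induces a linear endomorphism [h] of [U] with [h 1 = 0], and
    [h x = h x * 1] is the value at [x (x) 1 = 1 (x) x] of the linear map
    [x (x) y |-> h x * y]. *)
Lemma pb_free_epi (f : {linear cover -> E}) :
  (forall n, f (pb_free n) = 0) -> forall x, f x = 0.
Proof.
move=> f0; have [j jP] := pb_syz.
have [|h hE] := factor_through_surj cover_pi_surj (f := f).
  move=> x /eqP x0; have [_ jx] := jP (Kermod (g := cover_pi) x0).
  by rewrite -[x]jx f0.
have [k kE] : exists k : {linear tensor E E -> E},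
    forall x y, k (tens x y) = (((h x : U) * (y : U) : U) : E).
  apply: (@exists_tensor_lift _ E E E (fun x y => (h x : U) * (y : U) : U)).
  - by move=> x x' y; rewrite linearD; exact: mulrDl.
  - by move=> x y y'; exact: mulrDr.
  - by move=> a x y; rewrite linearZ !restr_scaleE mulrA.
  - by move=> a x y; rewrite !restr_scaleE mulrCA.
have [n [_ n1]] := pb_unit.
have h1 : h ((1 : U) : E) = 0.
  by rewrite -[X in h X]cover_pi_gen hE -/unit_gen -n1 f0.
move=> x; rewrite -hE.
have := kE (cover_pi x) ((1 : U) : E); rewrite epi_tens kE h1 => /esym.
by rewrite mulr1 mul0r.
Qed.

Hypothesis u_Tor : forall t : Tor1 E E, t = 0.

Lemma syz_tens_inj : injective (tensor_map (ker_incl cover_pi) (lin_id E)).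
Proof. exact: Tor1_vanish_inj. Qed.

Lemma pb_decomp (j : {linear kermod cover_pi -> pullback}) (e : pullback) :
  (forall z, pb_base (j z) = 0 /\ pb_free (j z) = ker_incl cover_pi z) ->
  pb_base e = 1 -> forall n, exists z, n = pb_base n *: e + j z.
Proof.
move=> jP e1 n; pose x := pb_free n - (pb_base n : R) *: pb_free e.
have x0 : cover_pi x == 0.
  rewrite linearB linearZZ -!pbP e1 subr_eq0; apply/eqP.
  by rewrite -linearZZ [_ *: _]mulr1.
have [b f] := jP (Kermod (g := cover_pi) x0).
exists (Kermod (g := cover_pi) x0).
apply: pb_ext; rewrite linearD linearZZ.
  by rewrite b addr0 e1 [RHS]mulr1.
by rewrite f [ker_incl _ _]/= addrC subrK.
Qed.

(** Both [pullback] and [cover] contain the syzygies of [U], with quotients [R]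
    and [U]. The assumption on [Tor1] keeps the second extension exact on the
    left after tensoring with [U], the first one splits, and the quotients
    become [U] and [U (x) U = U]. *)
Lemma pb_tens_bij :
  injective (tensor_map pb_free (lin_id E)) /\
  forall t, exists s, tensor_map pb_free (lin_id E) s = t.
Proof.
have [j jP] := pb_syz; have [e [e1 eF]] := pb_unit.
have jF t : tensor_map pb_free (lin_id E) (tensor_map j (lin_id E) t) =
    tensor_map (ker_incl cover_pi) (lin_id E) t.
  suff H : lin_comp (tensor_map pb_free (lin_id E)) (tensor_map j (lin_id E))
    =1 tensor_map (ker_incl cover_pi) (lin_id E) by exact: H.
  apply: tensor_ext => z y.
  rewrite -[LHS]/(tensor_map pb_free _ (tensor_map j (lin_id E) (tens z y))).
  by rewrite !tensor_mapE (jP z).2.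
split; last first.
  elim/tens_ind => [x y|t t' [s <-] [s' <-]]; last first.
    by exists (s + s'); rewrite linearD.
  (* In [U (x) U], the image of [x (x) y] is [1 (x) x y]. *)
  have [w wxy] : exists w, tensor_map (ker_incl cover_pi) (lin_id E) w =
      tens x y - tens unit_gen (((cover_pi x : U) * (y : U) : U) : E).
    apply: tensor_ker_l cover_pi_surj _ _.
    by rewrite linearB !tensor_mapE cover_pi_gen epi_tens subrr.
  exists (tensor_map j (lin_id E) w +
    tens e (((cover_pi x : U) * (y : U) : U) : E)).
  by rewrite linearD jF wxy tensor_mapE eF subrK.
suff inj0 t : tensor_map pb_free (lin_id E) t = 0 -> t = 0.
  move=> t t' tt'; apply/eqP; rewrite -subr_eq0; apply/eqP/inj0.
  by rewrite linearB tt' subrr.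
have [y [w ->]] : exists y w, t = tens e y + tensor_map j (lin_id E) w.
  elim/tens_ind: t => [n y|t t' [y [w ->]] [y' [w' ->]]]; last first.
    by exists (y + y'), (w + w'); rewrite linearD tensDr addrACA.
  have [z ->] := pb_decomp jP e1 n; exists ((pb_base n : R) *: y), (tens z y).
  by rewrite tensDl tensZl tensZr tensor_mapE.
rewrite linearD jF tensor_mapE => t0.
(* Multiplication in [U] sends [t] to [y], as the syzygies map to zero. *)
have y0 : y = 0.
  have := congr1 (fun t => restr_mul u (tensor_map cover_pi (lin_id E) t)) t0.
  rewrite linear0 linear0 linearD linearD tensor_mapE restr_mulE eF.
  rewrite cover_pi_gen.
  rewrite (_ : tensor_map cover_pi _ (tensor_map _ _ w) = 0).
    by rewrite linear0 addr0 mul1r.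
  elim/tens_ind: w {t0} => [z v|s s' s0 s'0].
    by rewrite !tensor_mapE kermodP tens0l.
  by rewrite !linearD s0 s'0 addr0.
move: t0; rewrite y0 !tens0r !add0r.
rewrite -(linear0 (tensor_map (ker_incl cover_pi) (lin_id E))).
by move=> /syz_tens_inj ->; rewrite linear0.
Qed.

End PartialResolution.

(** * Null forms *)

Section NullForms.
Variables (R U : comPzRingType) (u : {rmorphism R -> U}).

Local Notation N := (pullback u).
Local Notation F := (cover u).
Local Notation d := (pb_free u).
Local Notation b := (pb_base u).
Local Notation E := (restr u : lmodType R).

(** For the complex [d : N -> F], a bilinear map [T] on [N] is the component in
    degree [-2] of a chain map from the tensor square of that complex; [h] and
    [k] are the part of a null-homotopy that is visible in this degree. *)
Definition null_form (M : lmodType R) (T : N -> N -> M) : Prop :=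
  exists (h : {linear tensor N F -> M}) (k : {linear tensor F N -> M}),
    forall n m, T n m = h (tens n (d m)) + k (tens (d n) m).

Implicit Types M : lmodType R.

Lemma eq_null_form M (T T' : N -> N -> M) :
  (forall n m, T n m = T' n m) -> null_form T -> null_form T'.
Proof. by move=> TT [h [k hk]]; exists h, k => n m; rewrite -TT. Qed.

Lemma null_formB M (T T' : N -> N -> M) :
  null_form T -> null_form T' -> null_form (fun n m => T n m - T' n m).
Proof.
move=> [h [k hk]] [h' [k' hk']].
exists (lin_add h (lin_opp h')), (lin_add k (lin_opp k')) => n m.
by rewrite hk hk' opprD addrACA.
Qed.

Lemma null_form_comp M M' (f : {linear M -> M'}) (T : N -> N -> M) :
  null_form T -> null_form (fun n m => f (T n m)).
Proof.
move=> [h [k hk]]; exists (lin_comp f h), (lin_comp f k) => n m.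
by rewrite hk linearD.
Qed.

Lemma null_form_swap M (T : N -> N -> M) :
  null_form T -> null_form (fun n m => T m n).
Proof.
move=> [h [k hk]]; have [s sE] := tensor_swap F N.
have [s' sE'] := tensor_swap N F.
exists (lin_comp k s'), (lin_comp h s) => n m.
by rewrite hk addrC /= sE sE'.
Qed.

Lemma null_form_substl M (T : N -> N -> M) (f : {linear N -> N})
    (f' : {linear F -> F}) : (forall n, d (f n) = f' (d n)) ->
  null_form T -> null_form (fun n m => T (f n) m).
Proof.
move=> df [h [k hk]].
exists (lin_comp h (tensor_map f (lin_id F))).
exists (lin_comp k (tensor_map f' (lin_id N))) => n m.
rewrite -[X in _ = X + _]/(h (tensor_map _ _ (tens n (d m)))).
rewrite -[X in _ = _ + X]/(k (tensor_map _ _ (tens (d n) m))).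
by rewrite hk df !tensor_mapE.
Qed.

Lemma scale_linear (M : lmodType R) (a : R) : linear ( *:%R a : M -> M).
Proof. by move=> c x y; rewrite scalerDr !scalerA mulrC. Qed.

Lemma mulU_linear (v : U) : linear (fun x : E => ((x : U) * v : U) : E).
Proof. by move=> a x y; rewrite !restr_scaleE mulrDl mulrA. Qed.

(** On the basis [U] of [F], the map [mu] is the multiplication of [U]. *)
Lemma cover_product : exists mu : {linear tensor F F -> F},
  forall x y, cover_pi u (mu (tens x y)) =
    (cover_pi u x : U) * (cover_pi u y : U) :> U.
Proof.
have [L LE] : exists L : E -> {linear F -> F}, forall a c,
    L a (free_gen R c) = free_gen R (((a : U) * (c : U) : U) : E).
  exists (fun a =>
    free_lift (fun c => free_gen R (((a : U) * (c : U) : U) : E))).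
  by move=> a c; exact: free_liftE.
have [m mE] : exists m : F -> {linear F -> F}, forall y a,
    m y (free_gen R a) = L a y.
  exists (fun y => free_lift (fun a => L a y)).
  by move=> y a; exact: free_liftE.
have mP c y y' x : m (c *: y + y') x = c *: m y x + m y' x.
  pose h := lin_add (lin_comp (mklin (@scale_linear F c)) (m y)) (m y').
  suff H : m (c *: y + y') =1 h by exact: H.
  apply: free_ext => a; rewrite mE linearP.
  by rewrite -[RHS]/(c *: m y (free_gen R a) + m y' (free_gen R a)) !mE.
have m0 x : m 0 x = 0.
  by have := mP (-1) 0 0 x; rewrite scaler0 addr0 scaleN1r addNr.
have [mu muE] : exists mu : {linear tensor F F -> F},
    forall x y, mu (tens x y) = m y x.
  apply: (@exists_tensor_lift R F F F (fun x y => m y x)).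
  - by move=> x x' y; rewrite linearD.
  - by move=> x y y'; rewrite -[y]scale1r mP !scale1r.
  - by move=> a x y; rewrite linearZ.
  - by move=> a x y; rewrite -[a *: y]addr0 mP m0 addr0.
exists mu => x y; rewrite muE.
suff H : lin_comp (cover_pi u) (m y) =1
    lin_comp (mklin (mulU_linear (cover_pi u y))) (cover_pi u) by exact: H.
apply: free_ext => a; rewrite -[LHS]/(cover_pi u (m y (free_gen R a))) mE.
rewrite -[RHS]/((cover_pi u (free_gen R a) : U) * (cover_pi u y : U)).
rewrite cover_pi_gen mulrC.
suff H : lin_comp (cover_pi u) (L a) =1
    lin_comp (mklin (mulU_linear a)) (cover_pi u) by exact: H.
apply: free_ext => c; rewrite -[LHS]/(cover_pi u (L a (free_gen R c))).
rewrite -[RHS]/((cover_pi u (free_gen R c) : U) * (a : U)) cover_pi_gen LE.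
by rewrite cover_pi_gen mulrC.
Qed.

(** The two maps from the tensor square to the complex itself, which collapse
    one factor by [b], are homotopic: with [mu] as in [cover_product], both
    [b(n) y] and [mu(d n, y)] lie over the product of [u(b n)] with the image of
    [y] in [U], so that their difference, paired with [0], lies in [N]. *)
Lemma base_swap_null :
  null_form (fun n m : N => (b m : R) *: n - (b n : R) *: m).
Proof.
have [mu muE] := cover_product.
have [h0 h0E] : exists h : {linear tensor N F -> F},
    forall n y, h (tens n y) = (b n : R) *: y.
  apply: exists_tensor_lift => [n n' y|n y y'|a n y|a n y].
  - by rewrite linearD scalerDl.
  - by rewrite scalerDr.
  - by rewrite linearZ scalerA.
  - by rewrite !scalerA mulrC.
have [s sE] := tensor_swap F N.
have base_cover n : cover_pi u (d n) = u (b n) :> U by rewrite -pbP.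
have [p pE] : exists p : {linear tensor N F -> F},
    forall n y, p (tens n y) = mu (tens (d n) y) - (b n : R) *: y.
  exists (lin_add (lin_comp mu (tensor_map d (lin_id F))) (lin_opp h0)) => n y.
  rewrite -[LHS]/(mu (tensor_map d _ (tens n y)) - h0 (tens n y)).
  by rewrite tensor_mapE h0E.
have [q qE] : exists q : {linear tensor F N -> F},
    forall y n, q (tens y n) = (b n : R) *: y - mu (tens y (d n)).
  exists (lin_add (lin_comp h0 s)
    (lin_opp (lin_comp mu (tensor_map (lin_id F) d)))).
  move=> y n.
  rewrite -[LHS]/(h0 (s (tens y n)) - mu (tensor_map _ d (tens y n))).
  by rewrite tensor_mapE sE h0E.
have [|h hE] := @pb_lift _ _ u _ (lin_zero (tensor N F) R^o) p.
  move=> t; rewrite linear0.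
  elim/tens_ind: t => [n y|t t' t0 t'0]; last first.
    by rewrite !linearD -t0 -t'0 addr0.
  by rewrite pE linearB linearZZ muE base_cover restr_scaleE subrr.
have [|k kE] := @pb_lift _ _ u _ (lin_zero (tensor F N) R^o) q.
  move=> t; rewrite linear0.
  elim/tens_ind: t => [y n|t t' t0 t'0]; last first.
    by rewrite !linearD -t0 -t'0 addr0.
  by rewrite qE linearB linearZZ muE base_cover restr_scaleE mulrC subrr.
exists h, k => n m; apply: pb_ext.
  rewrite (linearB b) !(linearZZ b) linearD (hE _).1 (kE _).1 addr0.
  by rewrite [X in X - _](mulrC (b m : R)) subrr.
rewrite (linearB d) !(linearZZ d) linearD (hE _).2 (kE _).2 pE qE.
by rewrite [RHS]addrC addrA subrK.
Qed.

Hypothesis u_epi : ring_epi u.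
Hypothesis u_Tor : forall t : Tor1 E E, t = 0.

(** Let [Z] be the module of syzygies of [U], contained in [N] and in [F]. By
    [pb_tens_bij], right exactness and the flatness of [F], the square
<<
      N (x) Z  -->  N (x) F
         |             |
      F (x) Z  -->  F (x) F
>>
    is a pushout. Since [b] vanishes on [Z], so does the form when [m] lies in
    [Z]; this says that the two parts of the homotopy agree on [N (x) Z] up to
    sign, and hence extend to a map [omega] on [F (x) F]. For [m] the element
    [e] of [N] over [1 : R], the form is [theta], and both parts of the
    homotopy then depend only on [d n]. *)
Lemma base_form_factor M (theta : {linear N -> M}) :
  null_form (fun n m : N => (b m : R) *: theta n) ->
  exists chi : {linear F -> M}, forall n, theta n = chi (d n).
Proof.
move=> [h [k hk]]; have [j jP] := pb_syz u; have [e [e1 eF]] := pb_unit u.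
have [inj surj] := pb_tens_bij u_epi u_Tor.
pose i := ker_incl (cover_pi u).
pose Nd (P : lmodType R) := tensor_map d (lin_id P).
pose g : {linear (tensor N F * tensor F (kermod (cover_pi u)))%type ->
    tensor F F} :=
  lin_add (lin_comp (Nd F) (lin_fst _ _))
          (lin_comp (tensor_map (lin_id F) i) (lin_snd _ _)).
pose f : {linear (tensor N F * tensor F (kermod (cover_pi u)))%type -> M} :=
  lin_add (lin_comp h (lin_fst _ _))
    (lin_opp (lin_comp k (lin_comp (tensor_map (lin_id F) j) (lin_snd _ _)))).
have gE t s : g (t, s) = Nd F t + tensor_map (lin_id F) i s by [].
have fE t s : f (t, s) = h t - k (tensor_map (lin_id F) j s) by [].
have Nd_nat (P Q : lmodType R) (q : {linear P -> Q}) t :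
    Nd Q (tensor_map (lin_id N) q t) = tensor_map (lin_id F) q (Nd P t).
  suff H : lin_comp (Nd Q) (tensor_map (lin_id N) q) =1
      lin_comp (tensor_map (lin_id F) q) (Nd P) by exact: H.
  apply: tensor_ext => n y.
  rewrite -[LHS]/(Nd Q (tensor_map _ q (tens n y))).
  rewrite -[RHS]/(tensor_map _ q (Nd P (tens n y))).
  by rewrite !tensor_mapE.
have idp_surj (P : lmodType R) (y : P) : exists x, lin_id P x = y by exists y.
have [||omega omegaE] := @factor_through_surj _ _ _ _ g f.
(* The map [g] from the pushout is surjective, and its kernel is the image of
   [N (x) Z], on which [f] vanishes. *)
- move=> t; have [v vE] := surj (tensor_map (lin_id F) (cover_pi u) t).
  have [t' t'E] := tensor_map_surj (idp_surj N) (@cover_pi_surj _ _ u) v.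
  have [s sE] : exists s, tensor_map (lin_id F) i s = t - Nd F t'.
    apply: tensor_ker_r; first exact: cover_pi_surj.
    by rewrite linearB -Nd_nat t'E [Nd _ _]vE subrr.
  by exists (t', s); rewrite gE sE addrC subrK.
- move=> [t s]; rewrite gE fE => ts0.
  have [w wE] : exists w, tensor_map (lin_id N) i w = t.
    apply: tensor_ker_r; first exact: cover_pi_surj.
    apply: inj; rewrite linear0 [LHS]Nd_nat.
    have -> : Nd F t = - tensor_map (lin_id F) i s.
      by apply/eqP; rewrite -addr_eq0 ts0.
    rewrite linearN; apply/eqP; rewrite oppr_eq0; apply/eqP.
    elim/tens_ind: s {ts0} => [x z|s s' s0 s'0].
      by rewrite !tensor_mapE kermodP tens0r.
    by rewrite !linearD s0 s'0 addr0.
  have -> : s = - Nd _ w.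
    apply: (free_flat (@ker_incl_inj _ _ _ (cover_pi u))).
    rewrite linearN -Nd_nat wE; apply/eqP.
    by rewrite -addr_eq0 addrC ts0.
  rewrite -wE linearN linearN opprK.
  elim/tens_ind: w {wE t s ts0} => [n z|w w' w0 w'0]; last first.
    by rewrite !linearD addrACA w0 w'0 addr0.
  rewrite !tensor_mapE -(jP z).2 -hk (jP z).1.
  by rewrite scale0r.
have [chi chiE] : exists chi : {linear F -> M},
    forall x, chi x = omega (tens x (unit_gen u)) + k (tens x e).
  have lin : linear (fun x : F => omega (tens x (unit_gen u)) + k (tens x e)).
    move=> a x y; rewrite !tensDl !tensZl !linearP scalerDr.
    by rewrite addrACA.
  by exists (mklin lin).
exists chi => n; rewrite chiE.
have -> : tens (d n) (unit_gen u) = g (tens n (d e), 0).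
  by rewrite gE linear0 addr0 tensor_mapE eF.
rewrite omegaE fE (linear0 (tensor_map _ j)) (linear0 k) subr0 -hk e1.
by rewrite scale1r.
Qed.

(** Writing [~] for equality up to null forms, one has
<<
    b(m) b(f(g(n))) ~ b(g(n)) b(f(m)) ~ b(n) b(g(f(m))) ~ b(m) b(g(f(n)))
>>
    where each step is an instance of [base_swap_null]: for [g(n)] and [m] after
    applying [f], for [f(m)] and [n] after applying [g], and for [n] and [m]
    after applying [g] and [f]. Then [base_form_factor] applies. *)
Lemma chain_endo_comm (f g : {linear N -> N}) (f' g' : {linear F -> F}) :
  (forall n, d (f n) = f' (d n)) -> (forall n, d (g n) = g' (d n)) ->
  exists chi : {linear F -> R^o},
    forall n, b (f (g n)) - b (g (f n)) = chi (d n).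
Proof.
move=> df dg.
pose D n m : N := (b m : R) *: n - (b n : R) *: m.
have step (p q : {linear N -> N}) (p' : {linear F -> F}) :
    (forall n, d (p n) = p' (d n)) ->
    null_form (fun n m => b (q (D (p n) m))).
  move=> dp.
  apply: (null_form_comp (lin_comp b q) (T := fun n m => D (p n) m)).
  exact: null_form_substl dp base_swap_null.
pose theta := lin_add (lin_comp b (lin_comp f g))
  (lin_opp (lin_comp b (lin_comp g f))).
suff : null_form (fun n m : N => (b m : R) *: theta n).
  exact: base_form_factor.
have fg := step g f _ dg.
have gf := null_form_swap (step f g _ df).
have c := null_form_comp (lin_comp b (lin_comp g f)) base_swap_null.
apply: eq_null_form (null_formB (null_formB fg gf) c) => n m.
have vD (v : {linear N -> R^o}) x y :
    v (D x y) = (b y : R) *: v x - (b x : R) *: v y.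
  by rewrite /D (linearB v) !(linearZZ v).
rewrite -[b (f _)]/(lin_comp b f _) -[b (g (D _ _))]/(lin_comp b g _) !vD.
rewrite -[theta n]/(b (f (g n)) - b (g (f n))) scalerBr !opprB.
rewrite -[LHS]/((b m : R) * b (f (g n)) - (b (g n) : R) * b (f m) +
  ((b (f m) : R) * b (g n) - (b n : R) * b (g (f m))) +
  ((b n : R) * b (g (f m)) - (b m : R) * b (g (f n)))).
by rewrite (mulrC (b (g n) : R)) !addrA !subrK.
Qed.

End NullForms.

(** * Two-term complexes *)

Lemma span_image (R : pzRingType) (A B : lmodType R) (f : {linear A -> B})
    (S : set B) :
  (forall x, S x -> exists y, x = f y) ->
  forall x, Defs.span S x -> exists y, x = f y.
Proof.
move=> Sf x; elim=> [|y /Sf//|y z _ [y' ->] _ [z' ->]|a y _ [y' ->]].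
- by exists 0; rewrite linear0.
- by exists (y' + z'); rewrite linearD.
- by exists (a *: y'); rewrite linearZZ.
Qed.

Section TwoTerm.
Variable R : comPzRingType.
Implicit Types (A B : lmodType R) (X Y Z : cpx R).

Definition two_ob A B (i : int) : lmodType R :=
  match i with
  | Negz 0 => A
  | Posz 0 => B
  | _ => 'rV[R]_0
  end.

Definition two_d A B (d : {linear A -> B}) (i j : int) :
    {linear two_ob A B i -> two_ob A B j} :=
  match i, j with
  | Negz 0, Posz 0 => d
  | _, _ => lin_zero _ _
  end.

Lemma rV0_eq (v w : 'rV[R]_0) : v = w.
Proof. by rewrite (thinmx0 v) (thinmx0 w). Qed.

Section TwoCpx.
Variables (A B : lmodType R) (d : {linear A -> B}).

Lemma two_shape i j x : j != i + 1 -> two_d d i j x = 0.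
Proof. by case: i x => -[|n] //; case: j => -[|m]. Qed.

Lemma two_dd i j k x : two_d d j k (two_d d i j x) = 0.
Proof.
by case: i x => -[|n] x; case: j => -[|m] /=; rewrite ?linear0 //;
  case: k => -[|l].
Qed.

Lemma two_bounded :
  exists n : nat, forall i (x : two_ob A B i), (n < `|i|)%N -> x = 0.
Proof. by exists 1%N; case=> -[|n] //= x _; exact: thinmx0. Qed.

Definition two_cpx : cpx R := Cpx two_shape two_dd two_bounded.

Section MapOut.
Variables (X : cpx R) (a : {linear A -> X (Negz 0)}) (b : {linear B -> X 0}).
Hypothesis ab : forall x, b (d x) = cpx_d X (Negz 0) 0 (a x).
Hypothesis b0 : forall x, cpx_d X 0 1 (b x) = 0.

Definition two_out_fun (i : int) : {linear two_cpx i -> X i} :=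
  match i return {linear two_ob A B i -> X i} with
  | Negz 0 => a
  | Posz 0 => b
  | i => lin_zero _ _
  end.

Lemma two_out_d i j x :
  two_out_fun j (cpx_d two_cpx i j x) = cpx_d X i j (two_out_fun i x).
Proof.
have [ij|ij] := eqVneq j (i + 1); last first.
  by rewrite !cpx_shape // linear0.
subst j; case: i x => -[|n] x.
- by rewrite [RHS]b0 [cpx_d _ _ _ _]/= [LHS]linear0.
- rewrite [two_out_fun n.+1 x]/= [RHS]linear0.
  by rewrite [cpx_d _ _ _ _]/= [LHS]linear0.
- exact: ab.
- rewrite [two_out_fun (Negz n.+1) x]/= [RHS]linear0.
  by rewrite [cpx_d _ _ _ _]/= [LHS]linear0.
Qed.

Definition two_out : cmap two_cpx X := Cmap two_out_d.

End MapOut.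

Lemma two_out_ext X (f g : cmap two_cpx X) :
  f (Negz 0) =1 g (Negz 0) -> f 0 =1 g 0 -> f = g.
Proof.
move=> fgN fg0; apply: cmap_ext => -[] [|n] // x.
  by rewrite (thinmx0 x) !linear0.
by rewrite (thinmx0 x) !linear0.
Qed.

End TwoCpx.

Lemma K_cpxE (U : comPzRingType) (u : {rmorphism R -> U}) :
  K_cpx u = two_cpx (restr_map u).
Proof.
rewrite /K_cpx /two_cpx.
rewrite (Prop_irrelevance (@K_shape R U u) (two_shape (restr_map u))).
rewrite (Prop_irrelevance (@K_dd R U u) (two_dd (restr_map u))).
by rewrite (Prop_irrelevance (@K_bounded R U u) (two_bounded R^o (restr u))).
Qed.

Section TwoMap.
Variables (A B A' B' : lmodType R).
Variables (d : {linear A -> B}) (d' : {linear A' -> B'}).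
Variables (a : {linear A -> A'}) (b : {linear B -> B'}).
Hypothesis ab : forall x, b (d x) = d' (a x).

Definition two_map : cmap (two_cpx d) (two_cpx d') :=
  @two_out _ _ d (two_cpx d') a b ab (fun _ => erefl).

Lemma two_map_qi :
  (forall x, d x = 0 -> a x = 0 -> x = 0) ->
  (forall y, d' y = 0 -> exists x, d x = 0 /\ a x = y) ->
  (forall x y, b x = d' y -> exists z, x = d z) ->
  (forall y, exists x z, y - b x = d' z) -> quasi_iso two_map.
Proof.
move=> ai asurj bi bsurj; apply/quasi_isoP => -[] [|n].
- split=> [x _ [z xz]|y _]; first exact: bi xz.
  have [x [z yz]] := bsurj y; exists x; split; first by [].
  by exists z.
- split=> [x _ _|y _]; first by exists 0; exact: rV0_eq.
  by exists 0; split; [exact: linear0 | exists 0; exact: rV0_eq].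
- split=> [x dx [z az]|y dy].
    by exists 0; rewrite linear0; apply: ai.
  have [x [dx <-]] := asurj y dy; exists x; split; first by [].
  by exists 0; rewrite linear0 subrr.
- split=> [x _ _|y _]; first by exists 0; exact: rV0_eq.
  by exists 0; split; [exact: linear0 | exists 0; exact: rV0_eq].
Qed.

End TwoMap.

Lemma Db_map_cancel X Y Z (s : cmap X Y) (f g : Db_hom Z X) :
  quasi_iso s -> Db_map s \oD f = Db_map s \oD g -> f = g.
Proof.
by move=> s_qi e; rewrite -[f]Db_idl -(Db_invl s_qi) -Db_compA e Db_compA
  Db_invl Db_idl.
Qed.

Lemma Db_map_cancelr X Y Z (s : cmap X Y) (f g : Db_hom Y Z) :
  quasi_iso s -> f \oD Db_map s = g \oD Db_map s -> f = g.
Proof.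
by move=> s_qi e; rewrite -[f]Db_idr -(Db_invr s_qi) Db_compA e -Db_compA
  Db_invr Db_idr.
Qed.

(** A null-homotopic map out of a two-term complex [A -> B] factors through the
    contractible complex [B = B], whose identity is zero because its zero
    endomorphism is a quasi-isomorphism. *)
Lemma Db_map_homotopic A B (d : {linear A -> B}) X (f g : cmap (two_cpx d) X)
    (h : {linear B -> X (Negz 0)}) :
  (forall x, f (Negz 0) x = g (Negz 0) x + h (d x)) ->
  (forall x, f 0 x = g 0 x + cpx_d X (Negz 0) 0 (h x)) ->
  Db_map f = Db_map g.
Proof.
move=> fgN fg0; pose C := two_cpx (lin_id B).
pose c : cmap (two_cpx d) C :=
  @two_map _ _ _ _ d (lin_id B) d (lin_id B) (fun=> erefl).
have hd x : cpx_d X 0 1 (cpx_d X (Negz 0) 0 (h x)) = 0 by exact: cpx_dd.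
pose e : cmap C X := @two_out _ _ (lin_id B) X h
  (lin_comp (cpx_d X (Negz 0) 0) h) (fun=> erefl) hd.
have z_qi : quasi_iso (cmap_zero C C).
  have -> : cmap_zero C C = @two_map _ _ _ _ (lin_id B) (lin_id B)
      (lin_zero B B) (lin_zero B B) (fun=> erefl) by exact: two_out_ext.
  apply: two_map_qi => [x x0 _|y y0|x _ _|y].
  - exact: x0.
  - by exists 0; split => //; rewrite linear0.
  - by exists x.
  - by exists 0, y; rewrite subr0.
have zE : Db_map (cmap_zero C C) = Db_id C.
  apply: (Db_map_cancel z_qi); rewrite Db_idr Db_mapM; congr Db_map.
  exact: two_out_ext.
have -> : f = cmap_add g (cmap_comp e c) by exact: two_out_ext.
rewrite -Db_add_map -Db_mapM -[Db_map c]Db_idl -zE Db_compA !Db_mapM Db_add_map.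
by congr Db_map; apply: two_out_ext => x /=; rewrite !linear0 ?addr0.
Qed.

End TwoTerm.

(** * Truncation *)

Section Truncation.
Variable R : comPzRingType.
Implicit Types (A B N : lmodType R) (X Y Z : cpx R).

Section TruncObject.
Variable X : cpx R.

Definition coboundary : set (X (Negz 0)) :=
  fun x => exists y, x = cpx_d X (Negz 1) (Negz 0) y.

Lemma coboundary_pi0P x : quotmod_pi coboundary x = 0 <-> coboundary x.
Proof.
rewrite quotmod_pi0P; split=> [|xb]; last exact: span_gen.
exact: span_image.
Qed.

Definition trunc_ob (i : int) : lmodType R :=
  match i with
  | Posz n => X n
  | Negz 0 => quotmod coboundary
  | _ => 'rV[R]_0
  end.

Lemma trunc_d_coboundary j x : coboundary x -> cpx_d X (Negz 0) j x = 0.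
Proof. by move=> [y ->]; exact: cpx_dd. Qed.

Definition trunc_d (i j : int) : {linear trunc_ob i -> trunc_ob j} :=
  match i return {linear trunc_ob i -> trunc_ob j} with
  | Posz n => match j return {linear X n -> trunc_ob j} with
              | Posz m => cpx_d X n m
              | _ => lin_zero _ _
              end
  | Negz 0 => match j return {linear quotmod coboundary -> trunc_ob j} with
              | Posz m => quotmod_lift (@trunc_d_coboundary m)
              | _ => lin_zero _ _
              end
  | _ => lin_zero _ _
  end.

Lemma trunc_dE j x :
  trunc_d (Negz 0) (Posz j) (quotmod_pi coboundary x) = cpx_d X (Negz 0) j x.
Proof. exact: (quotmod_liftE (@trunc_d_coboundary j)). Qed.

Lemma trunc_shape i j x : j != i + 1 -> trunc_d i j x = 0.
Proof.
case: i x => [n|[|n]] x; case: j => [m|m] //=; first exact: cpx_shape.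
move=> mi; elim/quotmod_ind: x => x; rewrite [LHS]trunc_dE.
exact: cpx_shape.
Qed.

Lemma trunc_dd i j k x : trunc_d j k (trunc_d i j x) = 0.
Proof.
case: i x => [n|[|n]] x; last by rewrite [trunc_d _ j x]/= linear0.
- case: j => [m|m]; last by rewrite [trunc_d n _ x]/= linear0.
  by case: k => [p|p] //; exact: cpx_dd.
- case: j => [m|m]; last by rewrite [trunc_d _ _ x]/= linear0.
  case: k => [p|p] //; elim/quotmod_ind: x => x.
  by rewrite [trunc_d (Negz 0) _ _]trunc_dE; exact: cpx_dd.
Qed.

Lemma trunc_bounded :
  exists n : nat, forall i (x : trunc_ob i), (n < `|i|)%N -> x = 0.
Proof.
have [n nX] := cpx_bounded X; exists n.+1 => -[m|[|m]] x nm //.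
- exact/nX/ltnW.
- exact: thinmx0.
Qed.

(** The canonical truncation of [X] to degrees [-1] and above. *)
Definition trunc : cpx R := Cpx trunc_shape trunc_dd trunc_bounded.

Definition trunc_pi_fun (i : int) : {linear X i -> trunc i} :=
  match i return {linear X i -> trunc_ob i} with
  | Posz n => lin_id (X n)
  | Negz 0 => quotmod_pi coboundary
  | _ => lin_zero _ _
  end.

Lemma trunc_pi_d i j x :
  trunc_pi_fun j (cpx_d X i j x) = cpx_d trunc i j (trunc_pi_fun i x).
Proof.
have [ij|ij] := eqVneq j (i + 1); last by rewrite !cpx_shape // linear0.
subst j; case: i x => [n|[|[|n]]] x.
- by rewrite -PoszD.
- by rewrite [RHS]trunc_dE.
- by rewrite [RHS]linear0; apply/coboundary_pi0P; exists x.
- by [].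
Qed.

Definition trunc_pi : cmap X trunc := Cmap trunc_pi_d.

End TruncObject.

Section TruncMap.
Variables (X Y : cpx R) (f : cmap X Y).

Lemma trunc_map_coboundary x : coboundary x ->
  lin_comp (quotmod_pi (@coboundary Y)) (f (Negz 0)) x = 0.
Proof.
by move=> [y ->]; apply/coboundary_pi0P; rewrite cmap_d; exists (f _ y).
Qed.

Definition trunc_map_fun (i : int) : {linear trunc X i -> trunc Y i} :=
  match i return {linear trunc_ob X i -> trunc_ob Y i} with
  | Posz n => f n
  | Negz 0 => quotmod_lift trunc_map_coboundary
  | _ => lin_zero _ _
  end.

Lemma trunc_mapE x : trunc_map_fun (Negz 0) (quotmod_pi (@coboundary X) x) =
  quotmod_pi (@coboundary Y) (f (Negz 0) x).
Proof. exact: (quotmod_liftE trunc_map_coboundary). Qed.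

Lemma trunc_map_d i j x :
  trunc_map_fun j (cpx_d (trunc X) i j x) =
  cpx_d (trunc Y) i j (trunc_map_fun i x).
Proof.
have [ij|ij] := eqVneq j (i + 1); last by rewrite !cpx_shape // linear0.
subst j; case: i x => [n|[|n]] x.
- by rewrite -PoszD; exact: (@cmap_d _ _ _ f n (n + 1)%N x).
- elim/quotmod_ind: x => x.
  apply: etrans (congr1 (f 0) (trunc_dE 0 x)) _.
  apply: etrans (@cmap_d _ _ _ f (Negz 0) 0 x) (esym _).
  exact: etrans (congr1 (trunc_d Y (Negz 0) 0) (trunc_mapE x)) (trunc_dE 0 _).
- by rewrite [LHS]linear0.
Qed.

Definition trunc_map : cmap (trunc X) (trunc Y) := Cmap trunc_map_d.

Lemma trunc_map_pi :
  cmap_comp trunc_map (trunc_pi X) = cmap_comp (trunc_pi Y) f.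
Proof.
apply: cmap_ext => -[n|[|n]] x //.
exact: trunc_mapE.
Qed.

Lemma trunc_map_qi : quasi_iso f -> quasi_iso trunc_map.
Proof.
move=> /quasi_isoP fq; apply/quasi_isoP => -[[|n]|[|n]].
- have [fi fs] := fq 0; split=> [x dx [z]|y dy].
    elim/quotmod_ind: z => z; rewrite [RHS]trunc_dE => xz.
    have [w xw] := fi x dx (ex_intro _ z xz).
    by exists (quotmod_pi _ w); rewrite [RHS]trunc_dE.
  have [x [dx [z xz]]] := fs y dy; exists x; split; first exact: dx.
  by exists (quotmod_pi _ z); rewrite [RHS]trunc_dE.
- have := fq n.+1; have -> : (n.+1 : int) - 1 = n by rewrite intS addrC addKr.
  by rewrite -PoszD.
- have [fi fs] := fq (Negz 0); split=> [x|y].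
    elim/quotmod_ind: x => x; rewrite [cpx_d _ _ _ _]trunc_dE => dx [z].
    rewrite [LHS]trunc_mapE [RHS]linear0 => /coboundary_pi0P fx.
    have [w xw] := fi x dx fx; exists 0; rewrite linear0.
    by apply/coboundary_pi0P; exists w.
  elim/quotmod_ind: y => y; rewrite [cpx_d _ _ _ _]trunc_dE => dy.
  have [x [dx yx]] := fs y dy; exists (quotmod_pi _ x).
  rewrite [cpx_d _ _ _ _]trunc_dE [trunc_map _ _]trunc_mapE.
  split; first exact: dx.
  exists 0; rewrite linear0 -[LHS]linearB; apply/coboundary_pi0P; exact: yx.
- split=> [x _ _|y _].
    by exists 0; exact: rV0_eq.
  by exists 0; split; [exact: linear0 |
    exists 0; exact: rV0_eq].
Qed.

End TruncMap.

(** The component of [b] on the free module is chosen on the basis, together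
    with a homotopy [h]. The component on [N] is then uniquely determined,
    because the vanishing in degree [-2] makes an element of [X^-1] that is killed by
    both [d] and [s] zero; uniqueness makes it linear without any projectivity
    of [N]. *)
Lemma lift_along_qi (S : choiceType) N (d : {linear N -> freemod R S}) X Y
    (s : cmap X Y) (a : cmap (two_cpx d) Y) :
  quasi_iso s -> (forall x : X (Negz 1), x = 0) ->
  (forall y : Y (Negz 1), y = 0) ->
  exists b : cmap (two_cpx d) X, Db_map s \oD Db_map b = Db_map a.
Proof.
move=> /quasi_isoP sq X2 Y2.
have [si0 ss0] := sq 0; have [siN ssN] := sq (Negz 0).
pose F := freemod R S.
pose aF : {linear F -> Y 0} := a 0.
pose aN : {linear N -> Y (Negz 0)} := a (Negz 0).
have aNE n : cpx_d Y (Negz 0) 0 (aN n) = aF (d n).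
  exact: esym (@cmap_d _ _ _ a (Negz 0) 0 n).
have aF0 x : cpx_d Y 0 1 (aF x) = 0.
  by rewrite -[LHS](@cmap_d _ _ _ a 0 1 x) linear0.
have choose_basis (v : S) : exists w : X 0 * Y (Negz 0),
    cpx_d X 0 1 w.1 = 0 /\
    aF (free_gen R v) = s 0 w.1 + cpx_d Y (Negz 0) 0 w.2.
  have [x [dx [z xz]]] := ss0 (aF (free_gen R v)) (aF0 _).
  by exists (x, z); split; [exact: dx | rewrite -[cpx_d _ _ _ _]xz addrC subrK].
have [w wP] := choice choose_basis.
have [bF bFE] : exists bF : {linear F -> X 0},
    forall v, bF (free_gen R v) = (w v).1.
  by exists (free_lift (fun v => (w v).1)) => v; exact: free_liftE.
have [h hE] : exists h : {linear F -> Y (Negz 0)},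
    forall v, h (free_gen R v) = (w v).2.
  by exists (free_lift (fun v => (w v).2)) => v; exact: free_liftE.
have bF0 x : cpx_d X 0 1 (bF x) = 0.
  suff H : lin_comp (cpx_d X 0 1) bF =1 lin_zero F _ by exact: H.
  apply: free_ext => v; rewrite -[LHS]/(cpx_d X 0 1 (bF _)) bFE.
  exact: (wP v).1.
have aFE x : aF x = s 0 (bF x) + cpx_d Y (Negz 0) 0 (h x).
  suff H : aF =1 lin_add (lin_comp (s 0) bF) (lin_comp (cpx_d Y (Negz 0) 0) h).
    exact: H.
  apply: free_ext => v; rewrite (wP v).2 -bFE -hE.
  by [].
have [||w0|bN bNE] := @linear_of_graph R N (X (Negz 0)) (fun n w =>
  cpx_d X (Negz 0) 0 w = bF (d n) /\ aN n = s (Negz 0) w + h (d n)).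
- move=> c x y x' y' [dy ay] [dy' ay']; split.
    by rewrite !linearP dy dy'.
  by rewrite !linearP ay ay' scalerDr addrACA.
- move=> n; have [|x xE] := si0 (bF (d n)) (bF0 _).
    exists (aN n - h (d n)).
    by rewrite linearB [X in _ = X - _]aNE aFE addrK.
  have [|v [dv [z vz]]] := ssN (aN n - h (d n) - s (Negz 0) x).
    have sx : cpx_d Y (Negz 0) 0 (s (Negz 0) x) = s 0 (bF (d n)).
      by rewrite xE [RHS]cmap_d.
    rewrite !linearB [X in X - _ - _]aNE aFE addrK.
    exact: etrans (congr1 (fun y => _ - y) sx) (subrr _).
  exists (x + v); split.
    by rewrite linearD -[X in X + _]xE [X in _ + X]dv addr0.
  move: vz; rewrite (Y2 z) linear0 => /subr0_eq vz.
  by rewrite linearD -vz [X in _ = X + _]addrC !subrK.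
- move=> [dw sw]; have [||z ->] := siN w0.
  + by rewrite [LHS]dw !linear0.
  + by exists 0; rewrite linear0; move: sw; rewrite !linear0 addr0.
  + by rewrite (X2 z) linear0.
have bE n : bF (d n) = cpx_d X (Negz 0) 0 (bN n) by rewrite (bNE n).1.
exists (two_out bE bF0); rewrite Db_mapM; apply: esym.
apply: (@Db_map_homotopic _ _ _ d Y _ _ h) => [n|x]; first exact: (bNE n).2.
exact: aFE.
Qed.

(** Follows a chain map from [N -> F] along a zigzag. The intermediate complexes
    have to be truncated, because [lift_along_qi] fails for complexes with terms
    below degree [-1] as [N] need not be projective. The quantification over [k]
    after [b] is what makes the statement stable under composition and under
    inverses of quasi-isomorphisms. *)
Lemma trunc_point (S : choiceType) N (d : {linear N -> freemod R S}) X Y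
    (f : Db_hom X Y) (a : cmap (two_cpx d) (trunc X)) :
  exists b : cmap (two_cpx d) (trunc Y), forall k : Db_hom (two_cpx d) X,
    Db_map (trunc_pi X) \oD k = Db_map a ->
    Db_map (trunc_pi Y) \oD (f \oD k) = Db_map b.
Proof.
move: X Y f a.
apply: (@Db_ind R (fun X Y f => forall a : cmap (two_cpx d) (trunc X), _)).
- move=> X Y f a; exists (cmap_comp (trunc_map f) a) => k ka.
  by rewrite Db_compA Db_mapM -trunc_map_pi -Db_mapM -Db_compA ka Db_mapM.
- move=> X Y s s_qi a.
  have thin Z (x : trunc Z (Negz 1)) : x = 0 by exact: thinmx0.
  have s'_qi := trunc_map_qi s_qi.
  have [b bE] := lift_along_qi a s'_qi (thin _) (thin _).
  exists b => k ka; apply: (Db_map_cancel s'_qi).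
  by rewrite bE -ka !Db_compA Db_mapM trunc_map_pi -Db_mapM -!Db_compA
    [Db_map s \oD _]Db_compA Db_invr Db_idl.
- move=> X Y Z g f Hg Hf a; have [b bE] := Hf a; have [c cE] := Hg b.
  by exists c => k ka; rewrite -Db_compA; apply/cE/bE.
Qed.

Lemma trunc_two_retract A B (d : {linear A -> B}) :
  exists r : cmap (trunc (two_cpx d)) (two_cpx d),
    cmap_comp r (trunc_pi (two_cpx d)) = cmap_id (two_cpx d).
Proof.
have bound0 x : coboundary (X := two_cpx d) x -> lin_id A x = 0.
  by move=> [y ->].
pose r (i : int) : {linear trunc (two_cpx d) i -> two_cpx d i} :=
  match i return {linear trunc_ob (two_cpx d) i -> two_ob A B i} with
  | Posz 0 => lin_id B
  | Negz 0 => quotmod_lift bound0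
  | _ => lin_zero _ _
  end.
have r_d i j x : r j (cpx_d (trunc (two_cpx d)) i j x) =
    cpx_d (two_cpx d) i j (r i x).
  have [ij|ij] := eqVneq j (i + 1); last by rewrite !cpx_shape // linear0.
  subst j; case: i x => [n|[|n]] x.
  - by rewrite -PoszD; case: n x => [|n] x; apply: rV0_eq.
  - elim/quotmod_ind: x => x; rewrite [cpx_d _ _ _ _]trunc_dE.
    by rewrite [r (Negz 0) _](quotmod_liftE bound0).
  - by rewrite [LHS]linear0 [r _ x]/= [RHS]linear0.
exists (Cmap r_d); apply: two_out_ext => x //.
exact: quotmod_liftE.
Qed.

Lemma Db_comp_map_is_map (S : choiceType) N (d : {linear N -> freemod R S})
    A B A' B' (e : {linear A -> B}) (e' : {linear A' -> B'})
    (f : Db_hom (two_cpx e) (two_cpx e')) (s : cmap (two_cpx d) (two_cpx e)) :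
  exists phi : cmap (two_cpx d) (two_cpx e'), f \oD Db_map s = Db_map phi.
Proof.
have [b bE] := trunc_point f (cmap_comp (trunc_pi _) s).
have [r rE] := trunc_two_retract e'.
exists (cmap_comp r b); rewrite -Db_mapM -(bE (Db_map s)) ?Db_mapM //.
by rewrite Db_compA Db_mapM rE Db_idl.
Qed.

End Truncation.

(** * Endomorphisms of [K] in the derived category *)

Section Endomorphisms.
Variables (R U : comPzRingType) (u : {rmorphism R -> U}).

Local Notation K := (two_cpx (restr_map u)).
Local Notation K' := (two_cpx (pb_free u)).
Local Notation E := (restr u : lmodType R).

Lemma pb_square (n : pullback u) :
  cover_pi u (pb_free u n) = restr_map u (pb_base u n).
Proof. by rewrite pbP. Qed.

Definition pb_res : cmap K' K := two_map pb_square.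

Lemma pb_res_qi : quasi_iso pb_res.
Proof.
apply: two_map_qi => [n nF nB|r r0|x r xr|y].
- by apply: pb_ext; rewrite ?nF ?nB linear0.
- by have [|n [nB nF]] := @pb_point _ _ u r 0; [rewrite r0 linear0|exists n].
- by have [//|n [_ <-]] := @pb_point _ _ u r x; exists n.
- have [x <-] := cover_pi_surj y; exists x, 0.
  by rewrite subrr linear0.
Qed.

(** By [Db_comp_map_is_map] the composite is a chain map from [K'] to [K]. It
    lifts through [pb_res], because [cover] is free and [pullback] is a
    pullback. *)
Lemma Db_end_repr (f : Db_hom K K) :
  exists (h : {linear pullback u -> pullback u})
    (h' : {linear cover u -> cover u})
    (hh : forall n, h' (pb_free u n) = pb_free u (h n)),
    f \oD Db_map pb_res = Db_map (cmap_comp pb_res (two_map hh)).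
Proof.
have [phi phiE] := Db_comp_map_is_map f pb_res.
pose a : {linear pullback u -> R^o} := phi (Negz 0).
pose c : {linear cover u -> E} := phi 0.
have ac n : c (pb_free u n) = restr_map u (a n).
  exact: (@cmap_d _ _ _ phi (Negz 0) 0 n).
have [h' h'E] : exists h' : {linear cover u -> cover u},
    forall x, cover_pi u (h' x) = c x.
  pose h' : {linear cover u -> cover u} :=
    free_lift (fun v : E => free_gen R (c (free_gen R v))).
  exists h'; suff H : lin_comp (cover_pi u) h' =1 c by exact: H.
  apply: free_ext => v; rewrite -[LHS]/(cover_pi u (h' (free_gen R v))).
  by rewrite free_liftE cover_pi_gen.
have [|h hE] := @pb_lift _ _ u _ a (lin_comp h' (pb_free u)).
  by move=> n; rewrite -ac -h'E.
exists h, h', (fun n => esym (hE n).2).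
rewrite phiE; congr Db_map; apply: two_out_ext => x.
  exact: esym (hE x).1.
exact: esym (h'E x).
Qed.

Hypothesis u_epi : ring_epi u.
Hypothesis u_Tor : forall t : Tor1 E E, t = 0.

Lemma Db_end_comm (f g : Db_hom K K) : f \oD g = g \oD f.
Proof.
have [p [p' [pp fE]]] := Db_end_repr f; have [q [q' [qq gE]]] := Db_end_repr g.
apply: (Db_map_cancelr pb_res_qi); rewrite -!Db_compA fE gE.
rewrite -!Db_mapM !Db_compA fE gE !Db_mapM.
have [chi chiE] := chain_endo_comm u_epi u_Tor
  (fun n => esym (pp n)) (fun n => esym (qq n)).
have top n : pb_base u (p (q n)) = pb_base u (q (p n)) + chi (pb_free u n).
  by rewrite -chiE addrC subrK.
apply: (@Db_map_homotopic _ _ _ (pb_free u) K _ _ chi) => [n|x].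
  exact: top.
(* In degree [0], the difference and [u chi] agree on the image of [pb_free]. *)
pose bot : {linear cover u -> E} :=
  lin_add (lin_comp (cover_pi u) (lin_comp p' q'))
  (lin_opp (lin_add (lin_comp (cover_pi u) (lin_comp q' p'))
                    (lin_comp (restr_map u) chi))).
suff bot0 : bot x = 0 by apply: subr0_eq; exact: bot0.
apply: (pb_free_epi u_epi) => n.
rewrite -[bot _]/(cover_pi u (p' (q' (pb_free u n))) -
  (cover_pi u (q' (p' (pb_free u n))) + restr_map u (chi (pb_free u n)))).
by rewrite qq pp pp qq -!pbP top linearD subrr.
Qed.

End Endomorphisms.

(** * The case of an injective homomorphism *)

Section HomologyFunctor.
Variable R : comPzRingType.
Implicit Types X Y Z : cpx R.

Lemma bij_linear_inv (A B : lmodType R) (f : {linear A -> B}) :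
  bijective f -> exists g : {linear B -> A}, cancel f g /\ cancel g f.
Proof.
move=> [g fK gK].
have g_lin : linear g.
  by move=> a x y; rewrite -{1}[x]gK -{1}[y]gK -linearP fK.
by exists (mklin g_lin).
Qed.

Fixpoint zz_H (i : int) X Y (f : zigzag X Y) :
    {linear cohomology X i -> cohomology Y i} :=
  match f with
  | zz_map _ _ f => cohomology_map f i
  | zz_inv _ _ s s_qi => sval (cid (bij_linear_inv (s_qi i)))
  | zz_comp _ _ _ g f => lin_comp (zz_H i g) (zz_H i f)
  end.

Lemma cohomology_mapE X Y (f : cmap X Y) i x :
  cohomology_map f i (quotmod_pi _ x) = quotmod_pi _ (cocycle_map f i x).
Proof. exact: (quotmod_liftE (@cmap_boundP _ _ _ f i)). Qed.

Lemma cohomology_map_comp X Y Z (g : cmap Y Z) (f : cmap X Y) i x :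
  cohomology_map (cmap_comp g f) i x =
  cohomology_map g i (cohomology_map f i x).
Proof.
elim/quotmod_ind: x => x; rewrite !cohomology_mapE.
by congr quotmod_pi; apply: val_inj.
Qed.

Lemma cohomology_map_id X i x : cohomology_map (cmap_id X) i x = x.
Proof.
elim/quotmod_ind: x => x; rewrite cohomology_mapE.
by congr quotmod_pi; apply: val_inj.
Qed.

Lemma zz_H_eq i X Y (f g : zigzag X Y) : zz_eq f g -> zz_H i f =1 zz_H i g.
Proof.
elim=> {X Y f g} [//|X Y f g _ fg|X Y f g h _ fg _ gh
  |X Y Z g g' f f' _ gg _ ff|//|X Y f|X Y f
  |X Y Z g f|X Y s s_qi|X Y s s_qi] x /=.
- by rewrite fg.
- by rewrite fg gh.
- by rewrite ff gg.
- exact: cohomology_map_id.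
- exact: congr1 (cohomology_map_id x).
- exact: esym (cohomology_map_comp g f x).
- case: cid => t [sK tK] /=; apply: etrans (sK x) _.
  exact: esym (cohomology_map_id x).
- case: cid => t [sK tK] /=; apply: etrans (tK x) _.
  exact: esym (cohomology_map_id x).
Qed.

End HomologyFunctor.

Section Cokernel.
Variables (R U : comPzRingType) (u : {rmorphism R -> U}).

Local Notation K := (two_cpx (restr_map u)).
Local Notation Q := (coker u).
Local Notation C := (two_cpx (lin_zero 'rV[R]_0 Q)).

Definition coker_pi : {linear restr u -> Q} := quotmod_pi (range (restr_map u)).

Lemma coker_pi0P x : coker_pi x = 0 <-> exists r, x = restr_map u r.
Proof.
rewrite /coker_pi quotmod_pi0P; split=> [|[r ->]].
  by apply: span_image => _ [r _ <-]; exists r.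
by apply: span_gen; exists r.
Qed.

Lemma coker_square r : coker_pi (restr_map u r) =
  lin_zero 'rV[R]_0 Q (lin_zero R^o 'rV[R]_0 r).
Proof. by apply/coker_pi0P; exists r. Qed.

Definition K_coker : cmap K C := two_map coker_square.

Lemma K_coker_qi : injective u -> quasi_iso K_coker.
Proof.
move=> u_inj; apply: two_map_qi => [r r0 _|y _|x y|y].
- by apply: u_inj; rewrite rmorph0.
- by exists 0; split; [exact: linear0|exact: rV0_eq].
- by move=> /coker_pi0P.
- by elim/quotmod_ind: y => y; exists y, 0; rewrite linear0 subrr.
Qed.

Definition coker_end (h : {linear Q -> Q}) : cmap C C :=
  @two_map _ _ _ _ _ (lin_zero 'rV[R]_0 Q) (lin_zero _ _) (lin_id _) h
    (fun _ => linear0 h).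

Lemma coker_end_inj (h h' : {linear Q -> Q}) :
  Db_map (coker_end h) = Db_map (coker_end h') -> h = h'.
Proof.
move=> /Db_classP hE; have hh := @zz_H_eq R 0 _ _ _ _ hE.
apply: linear_ext => x.
have x0 : x \in Defs.lker (cpx_d C 0 (0 + 1)) by rewrite inE.
have := hh (quotmod_pi _ (Kermod x0)).
rewrite -[zz_H _ _]/(cohomology_map _ 0).
rewrite -[zz_H _ (zz_map (coker_end h'))]/(cohomology_map _ 0).
rewrite !cohomology_mapE => /eqP.
rewrite -subr_eq0 -linearB => /eqP /cohomology_pi0P[z].
by move=> /subr0_eq.
Qed.

Hypothesis u_inj : injective u.

Let q_qi := K_coker_qi u_inj.

Definition coker_end_Db (h : {linear Q -> Q}) : Db_hom K K :=
  Db_inv q_qi \oD Db_map (coker_end h) \oD Db_map K_coker.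

Lemma coker_end_DbE h :
  Db_map K_coker \oD coker_end_Db h = Db_map (coker_end h) \oD Db_map K_coker.
Proof. by rewrite /coker_end_Db !Db_compA Db_invr Db_idl. Qed.

Lemma coker_end_Db_inj : injective coker_end_Db.
Proof.
move=> h h' hh; apply: coker_end_inj; apply: (Db_map_cancelr q_qi).
by rewrite -!coker_end_DbE hh.
Qed.

Lemma coker_end_Db_surj f : exists h, coker_end_Db h = f.
Proof.
have [phi phiE] := Db_comp_map_is_map f (pb_res u).
pose c : {linear cover u -> restr u} := phi 0.
have [||h hE] := @factor_through_surj R (cover u) Q Q
  (lin_comp coker_pi (cover_pi u)) (lin_comp coker_pi c).
- by elim/quotmod_ind=> y; have [x <-] := cover_pi_surj y; exists x.
- move=> x /coker_pi0P[r xr]; apply/coker_pi0P.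
  have [//|n [_ <-]] := @pb_point _ _ u r x.
  exists (phi (Negz 0) n).
  exact: (@cmap_d _ _ _ phi (Negz 0) 0 n).
exists h; apply: (Db_map_cancel q_qi); rewrite coker_end_DbE.
apply: (Db_map_cancelr (pb_res_qi u)).
rewrite -!Db_compA phiE !Db_mapM; congr Db_map.
apply: two_out_ext => x; first exact: rV0_eq.
exact: hE.
Qed.

Lemma coker_end_Db_ring : ring_isomorphism (mod_end Q) (Db_end K) coker_end_Db.
Proof.
have [g gK] := choice coker_end_Db_surj.
split.
- by exists g => // h; apply: coker_end_Db_inj; rewrite gK.
- apply: (Db_map_cancel q_qi); rewrite coker_end_DbE Db_idr Db_mapM.
  by congr Db_map; exact: two_out_ext.
- move=> h h'; apply: (Db_map_cancel q_qi); rewrite coker_end_DbE.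
  rewrite [RHS]Db_compDr !coker_end_DbE -Db_compDl Db_add_map.
  congr (Db_map _ \oD _); apply: two_out_ext => x //.
  exact: rV0_eq.
- move=> h h'; apply: (Db_map_cancel q_qi); rewrite coker_end_DbE.
  rewrite [RHS]Db_compA coker_end_DbE -Db_compA coker_end_DbE Db_compA !Db_mapM.
  by congr Db_map; exact: two_out_ext.
Qed.

End Cokernel.

Lemma ring_isomorphism_inv T T' (A : ring_on T) (B : ring_on T') (f : T -> T') :
  ring_isomorphism A B f -> exists g, ring_isomorphism B A g.
Proof.
case=> -[g fK gK] f1 fD fM; exists g; split.
- by exists f.
- by rewrite -f1 fK.
- by move=> x y; rewrite -{1}[x]gK -{1}[y]gK -fD fK.
- by move=> x y; rewrite -{1}[x]gK -{1}[y]gK -fM fK.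
Qed.

Lemma ring_isomorphism_comm T T' (A : ring_on T) (B : ring_on T')
    (f : T -> T') :
  ring_isomorphism A B f -> ring_commutative B -> ring_commutative A.
Proof.
case=> /bij_inj f_inj _ _ fM Bcomm x y.
by apply: f_inj; rewrite !fM Bcomm.
Qed.

Theorem lemma4p1 (R U : comPzRingType) (u : {rmorphism R -> U})
  (u_epi : ring_epi u)
  (u_Tor : forall t : Tor1 (restr u) (restr u), t = 0) :
  ring_commutative (Db_end (K_cpx u)) /\
  (injective u ->
     (exists phi : Db_hom (K_cpx u) (K_cpx u) ->
                   {linear coker u -> coker u},
        ring_isomorphism (Db_end (K_cpx u)) (mod_end (coker u)) phi) /\
     ring_commutative (mod_end (coker u))).
Proof.
rewrite K_cpxE; have comm : ring_commutative (Db_end (two_cpx (restr_map u))).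
  by move=> f g; exact: (Db_end_comm u_epi u_Tor).
split=> // u_inj; have iso := coker_end_Db_ring u_inj.
split; first exact: ring_isomorphism_inv iso.
exact: ring_isomorphism_comm iso comm.
Qed.
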